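(* Let $(R,\mathfrak m)$ be a one-dimensional Cohen-Macaulay local ring with infinite residue field that admits a canonical reduction $K$. Let $\mathfrak C_R$ be the set of canonical ideals of $R$ and $S_{\mathfrak C_R}=\{\ell(R/J)\mid J\in\mathfrak C_R\}$. Then: (a) For each canonical ideal $J$ of $R$, $\ell(R/J)\ge\ell(R/K)$, and equality holds if and only if $J$ is a reduction of $\mathfrak m$. In particular, $\min(S_{\mathfrak C_R})=\ell(R/K)$. (b) $\ell(R/K)\le e^0_{\mathfrak m}(R)-r(R)+1$, and equality holds if and only if $R$ is almost Gorenstein.
   Context: $\ell$ denotes length, $e^0_{\mathfrak m}(R)$ the multiplicity of $R$, and $r(R)=\ell(\operatorname{Ext}^1_R(R/\mathfrak m,R))$ the Cohen-Macaulay type. A canonical ideal of $R$ is a proper ideal of $R$ isomorphic to a canonical module $K_R$. An ideal $J\subseteq I$ is a reduction of $I$ if $I^{n+1}=JI^n$ for some $n$. A canonical reduction is a canonical ideal that is a reduction of $\mathfrak m$. The one-dimensional ring $R$ is almost Gorenstein if there is an exact sequence of $R$-modules $0\to R\to K_R\to C\to0$ with $\mathfrak mC=0$. *)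

(* Defs.v *)
From HB Require Import structures.
From mathcomp Require Import all_boot all_order all_algebra.
From mathcomp Require Import boolp classical_sets functions cardinality.
From mathcomp Require Import constructive_ereal ereal.

Set Implicit Arguments.
Unset Strict Implicit.
Unset Printing Implicit Defensive.

Import Order.TTheory GRing.Theory Num.Theory.

Local Open Scope classical_set_scope.
Local Open Scope ring_scope.

(* Ideals of [R] are submodules of the regular module [R^o]; unlike MathComp's
   [idealr], they are not assumed to be proper. *)
Notation ideal R := (submodClosed R^o).

Section SubQuotient.
Variables (R : comNzRingType) (V : lmodType R) (N : submodClosed V).

Definition submod : Type := {x : V | x \in N}.

HB.instance Definition _ := SubChoice.on submod.
HB.instance Definition _ := [SubChoice_isSubLmodule of submod by <:].

(* The quotient construction of MathComp expects a [zmodClosed] predicate. *)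
Definition quotmod_kernel : {pred V} := fun x => x \in N.

Fact quotmod_kernel_zmod_closed : zmod_closed quotmod_kernel.
Proof. exact: GRing.submod_closedB (submodClosedP N). Qed.

HB.instance Definition _ :=
  GRing.isZmodClosed.Build V quotmod_kernel quotmod_kernel_zmod_closed.

Definition quotmod : Type := Quotient.quot quotmod_kernel.

HB.instance Definition _ := GRing.Zmodule.on quotmod.

Definition quotmod_pi (x : V) : quotmod :=
  \pi_(Quotient.quot quotmod_kernel)%qT x.

Definition quotmod_scale (a : R) (x : quotmod) : quotmod :=
  quotmod_pi (a *: (repr x : V)).

Lemma quotmod_piK (x : quotmod) : quotmod_pi (repr x) = x.
Proof. exact: reprK. Qed.

Lemma quotmod_piE (x y : V) : (quotmod_pi x == quotmod_pi y) = (x - y \in N).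
Proof. by rewrite (Quotient.idealrBE quotmod_kernel). Qed.

Lemma quotmod_piD (x y : V) :
  quotmod_pi (x + y) = quotmod_pi x + quotmod_pi y.
Proof. exact: (raddfD \pi_(Quotient.quot quotmod_kernel)%qT). Qed.

Lemma quotmod_scale_pi a (x : V) :
  quotmod_scale a (quotmod_pi x) = quotmod_pi (a *: x).
Proof.
apply/eqP; rewrite quotmod_piE -scalerBr rpredZ // -quotmod_piE.
by rewrite quotmod_piK.
Qed.

Fact quotmod_scaleA a b (x : quotmod) :
  quotmod_scale a (quotmod_scale b x) = quotmod_scale (a * b) x.
Proof. by rewrite -[x]quotmod_piK !quotmod_scale_pi scalerA. Qed.

Fact quotmod_scale1 : left_id 1 quotmod_scale.
Proof. by move=> x; rewrite -[x]quotmod_piK quotmod_scale_pi scale1r. Qed.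

Fact quotmod_scaleDr : right_distributive quotmod_scale +%R.
Proof.
move=> a x y; rewrite -[x]quotmod_piK -[y]quotmod_piK -quotmod_piD.
by rewrite !quotmod_scale_pi scalerDr quotmod_piD.
Qed.

Fact quotmod_scaleDl (x : quotmod) :
  {morph quotmod_scale^~ x : a b / a + b}.
Proof.
move=> a b; rewrite -[x]quotmod_piK.
by rewrite !quotmod_scale_pi scalerDl quotmod_piD.
Qed.

HB.instance Definition _ := GRing.Zmodule_isLmodule.Build R quotmod
  quotmod_scaleA quotmod_scale1 quotmod_scaleDr quotmod_scaleDl.

End SubQuotient.

Definition finitely_generated (R : comNzRingType) (V : lmodType R) : Prop :=
  exists s : seq V, forall v : V,
    exists c : nat -> R, v = \sum_(i < size s) c i *: s`_i.

Definition noetherian (R : comNzRingType) : Prop :=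
  forall I : ideal R, finitely_generated (submod I).

Definition lmod_iso (R : comNzRingType) (U V : lmodType R) : Prop :=
  exists f : {linear U -> V}, bijective f.

Definition strict_subset (T : Type) (A B : {pred T}) : Prop :=
  {subset A <= B} /\ ~ {subset B <= A}.

(* Lengths and dimensions are suprema in [\bar rat] of lengths of strict
   chains, so that they can be compared with values of Hilbert polynomials. *)
Definition length (R : comNzRingType) (V : lmodType R) : \bar rat :=
  ereal_sup [set n%:R%:E | n in [set n : nat |
    exists N : nat -> submodClosed V,
      forall i, (i < n)%N -> strict_subset (N i) (N i.+1)]].

Definition krull_dim (R : comNzRingType) : \bar rat :=
  ereal_sup [set n%:R%:E | n in [set n : nat |
    exists P : nat -> prime_idealr R,
      forall i, (i < n)%N -> strict_subset (P i) (P i.+1)]].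

(* The dimension as a natural number, meaningful when it is finite. *)
Definition dimn (R : comNzRingType) : nat := Num.truncn (fine (krull_dim R)).

Definition maximal_ideal (R : comNzRingType) (m : ideal R) : Prop :=
  1 \notin m /\
  forall I : ideal R, 1 \notin I -> {subset m <= I} -> {subset I <= m}.

Definition local_ring (R : comNzRingType) (m : ideal R) : Prop :=
  maximal_ideal m /\ forall n : ideal R, maximal_ideal n -> n =i m.

Section ScaleImage.
Variables (R : comNzRingType) (x : R) (V : lmodType R).

Definition scale_image : {pred V} := fun v => `[< exists u : V, v = x *: u >].

Fact scale_image_submod_closed : submod_closed scale_image.
Proof.
split=> [|a u v /asboolP[u' ->] /asboolP[v' ->]]; apply/asboolP.
  by exists 0; rewrite scaler0.
by exists (a *: u' + v'); rewrite scalerDr !scalerA mulrC.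
Qed.

HB.instance Definition _ :=
  GRing.isSubmodClosed.Build R V scale_image
    (GRing.submod_closed_semi scale_image_submod_closed).

End ScaleImage.

Arguments scale_image {R} x V _.

Fixpoint regular_seq (R : comNzRingType) (V : lmodType R) (s : seq R) : Prop :=
  if s is x :: s' then
    injective (fun v : V => x *: v) /\ regular_seq (quotmod (scale_image x V)) s'
  else exists v : V, v != 0.

Definition depth (R : comNzRingType) (m : ideal R) (V : lmodType R) : \bar rat :=
  ereal_sup [set (size s)%:R%:E | s in [set s : seq R |
    {subset s <= m} /\ regular_seq V s]].

Definition cohen_macaulay_local (R : comNzRingType) (m : ideal R) : Prop :=
  [/\ noetherian R, local_ring m & depth m R^o = krull_dim R].

Section IdealProduct.
Variables (R : comNzRingType) (I J : ideal R).

Definition ideal_mul : {pred R^o} := fun x =>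
  `[< exists s : seq (R * R),
        (forall p, p \in s -> p.1 \in I /\ p.2 \in J) /\
        x = \sum_(p <- s) p.1 * p.2 >].

Fact ideal_mul_submod_closed : submod_closed ideal_mul.
Proof.
split=> [|a u v /asboolP[s [sIJ ->]] /asboolP[t [tIJ ->]]]; apply/asboolP.
  by exists [::]; rewrite big_nil.
exists ([seq (a * p.1, p.2) | p <- s] ++ t); split=> [p|].
  rewrite mem_cat => /orP[/mapP[q /sIJ[qI qJ] ->]|/tIJ//].
  by split=> //=; exact: (@rpredZ _ _ I a _ qI).
rewrite big_cat big_map /= /GRing.scale /= mulr_sumr; congr (_ + _).
by apply: eq_bigr => p _; rewrite mulrA.
Qed.

HB.instance Definition _ :=
  GRing.isSubmodClosed.Build R R^o ideal_mul
    (GRing.submod_closed_semi ideal_mul_submod_closed).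

End IdealProduct.

Section UnitIdeal.
Variable R : comNzRingType.

Definition unit_ideal : {pred R^o} := fun=> true.

Fact unit_ideal_submod_closed : submod_closed unit_ideal. Proof. by []. Qed.

HB.instance Definition _ :=
  GRing.isSubmodClosed.Build R R^o unit_ideal
    (GRing.submod_closed_semi unit_ideal_submod_closed).

End UnitIdeal.

Arguments unit_ideal R _ : clear implicits.

Definition ideal_exp (R : comNzRingType) (I : ideal R) (n : nat) : ideal R :=
  iter n (fun J : ideal R => ideal_mul I J : ideal R) (unit_ideal R : ideal R).

Definition reduction (R : comNzRingType) (J I : ideal R) : Prop :=
  {subset J <= I} /\
  exists n, ideal_exp I n.+1 =i ideal_mul J (ideal_exp I n).

(* [d`!] times the coefficient of degree [d = dim R] of the Hilbert-Samuel
   polynomial of [m] *)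
Definition multiplicity (R : comNzRingType) (m : ideal R) : rat :=
  xget 0 [set e : rat | exists2 P : {poly rat},
    exists n0, forall n, (n0 <= n)%N ->
      length (quotmod (ideal_exp m n.+1)) = P.[n%:R]%:E
    & e = (dimn R)`!%:R * P`_(dimn R)].

Definition exact_at (R : comNzRingType) (U V W : lmodType R)
    (f : {linear U -> V}) (g : {linear V -> W}) : Prop :=
  range f = [set y | g y = 0].

Definition projective (R : comNzRingType) (P : lmodType R) : Prop :=
  forall (A B : lmodType R) (g : {linear A -> B}) (f : {linear P -> B}),
    range g = setT ->
    exists h : {linear P -> A}, forall x, g (h x) = f x.

Definition injective_module (R : comNzRingType) (E : lmodType R) : Prop :=
  forall (A B : lmodType R) (g : {linear A -> B}) (f : {linear A -> E}),
    injective g ->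
    exists h : {linear B -> E}, forall x, h (g x) = f x.

(* ... -> res_obj 2 -> res_obj 1 -> res_obj 0 -> M -> 0 *)
Record projective_resolution (R : comNzRingType) (M : lmodType R) := {
  res_obj :> nat -> lmodType R;
  res_diff : forall i, {linear res_obj i.+1 -> res_obj i};
  res_aug : {linear res_obj 0%N -> M};
  res_projective : forall i, projective (res_obj i);
  res_aug_surj : range res_aug = setT;
  res_exact0 : exact_at (res_diff 0%N) res_aug;
  res_exactS : forall i, exact_at (res_diff i.+1) (res_diff i)
}.

Section Ext.
Variables (R : comNzRingType) (M : lmodType R) (F : projective_resolution M).
Variables (N : lmodType R) (i : nat).

Definition cocycle : {pred (F i -> N)} := fun f =>
  `[< linear f /\ forall x, f (res_diff F i x) = 0 >].

Fact cocycle_submod_closed : submod_closed cocycle.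
Proof.
split=> [|a f g /asboolP[lf f0] /asboolP[lg g0]]; apply/asboolP.
  by split=> // b x y /=; rewrite scaler0 addr0.
split=> [b x y|x] /=; rewrite !fctE.
  rewrite lf lg !scalerDr !scalerA mulrC -!addrA; congr (_ + _).
  by rewrite addrCA.
by rewrite f0 g0 scaler0 addr0.
Qed.

HB.instance Definition _ :=
  GRing.isSubmodClosed.Build R (F i -> N) cocycle
    (GRing.submod_closed_semi cocycle_submod_closed).

Definition is_coboundary : (F i -> N) -> Prop :=
  match i return (F i -> N) -> Prop with
  | 0%N => fun f => forall x, f x = 0
  | j.+1 => fun f =>
      exists g : {linear F j -> N}, forall x, f x = g (res_diff F j x)
  end.

Fact is_coboundary0 : is_coboundary 0.
Proof. by rewrite /is_coboundary; case: i => [//|j]; exists \0 => x. Qed.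

Fact is_coboundaryP a (f g : F i -> N) :
  is_coboundary f -> is_coboundary g -> is_coboundary (a *: f + g).
Proof.
rewrite /is_coboundary; case: i f g => [|j] f g.
  by move=> f0 g0 x; rewrite !fctE f0 g0 scaler0 addr0.
move=> [f' f'E] [g' g'E]; exists (a \*: f' \+ g') => x.
by rewrite !fctE f'E g'E.
Qed.

Definition coboundary : {pred submod cocycle} :=
  fun z => `[< is_coboundary (val z) >].

Fact coboundary_submod_closed : submod_closed coboundary.
Proof.
split=> [|a f g /asboolP Bf /asboolP Bg]; apply/asboolP.
  exact: is_coboundary0.
exact: is_coboundaryP.
Qed.

HB.instance Definition _ := GRing.isSubmodClosed.Build R (submod cocycle)
  coboundary (GRing.submod_closed_semi coboundary_submod_closed).

(* Ext^i(M, N), computed as the i-th cohomology of Hom(F, N) *)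
Definition Ext : lmodType R := quotmod coboundary.

End Ext.

(* By the comparison theorem the value does not depend on the resolution. *)
Definition length_Ext (R : comNzRingType) (i : nat) (M N : lmodType R) :
    \bar rat :=
  xget 0%E [set l | exists F : projective_resolution M, l = length (Ext F N i)].

Definition finite_injective_dimension (R : comNzRingType) (M : lmodType R) :
    Prop :=
  exists (n : nat) (E : nat -> lmodType R)
    (d : forall i, {linear E i -> E i.+1}) (eta : {linear M -> E 0%N}),
  [/\ forall i, injective_module (E i),
      forall i, (n < i)%N -> forall x : E i, x = 0,
      injective eta,
      exact_at eta (d 0%N) &
      forall i, exact_at (d i) (d i.+1)].

(* A canonical module is a maximal Cohen-Macaulay module of type 1 and of
   finite injective dimension (Bruns-Herzog, Definition 3.3.1); the type is the
   length of Ext^d(R/m, C) for d = depth C = dim R. *)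
Definition canonical_module (R : comNzRingType) (m : ideal R)
    (C : lmodType R) : Prop :=
  [/\ finitely_generated C,
      depth m C = krull_dim R,
      length_Ext (dimn R) (quotmod m) C = 1%:E &
      finite_injective_dimension C].

Definition canonical_ideal (R : comNzRingType) (m J : ideal R) : Prop :=
  1 \notin J /\ exists2 C : lmodType R, canonical_module m C &
                                         lmod_iso (submod J) C.

Definition canonical_reduction (R : comNzRingType) (m K : ideal R) : Prop :=
  canonical_ideal m K /\ reduction K m.

Definition almost_gorenstein (R : comNzRingType) (m : ideal R) : Prop :=
  exists (KR C : lmodType R) (f : {linear R^o -> KR}) (g : {linear KR -> C}),
  [/\ canonical_module m KR, injective f, exact_at f g, range g = setT &
      forall (a : R) (c : C), a \in m -> a *: c = 0].

(* Main.v *)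
Require Import Defs.
From HB Require Import structures.
From mathcomp Require Import all_boot all_order all_algebra.
From mathcomp Require Import boolp classical_sets functions cardinality.
From mathcomp Require Import constructive_ereal ereal.
From mathcomp Require Import finmap zify.

(* Proof idea. Fix a regular element x in m.

   A finite injective resolution of a canonical module C is used only through the
   vanishing of Ext^1(I, C) for m-primary ideals I, which says that maps
   I -> C/xC lift to C. It is obtained by descending along the cosyzygies, using
   that R/m embeds into R/xR. Hence C/xC behaves like the injective hull of R/m
   over R/xR: by counting lengths l(C/xC) = l(R/xR) and l(C/mC) is the length of
   the socle of R/xR, which is Ext^1(R/m, R); and an isomorphism K/xK -> C/xC
   lifts to an isomorphism K -> C, so canonical ideals are isomorphic.

   (a) An isomorphism K -> J is multiplication by a fraction a/b, so bJ = aK.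
   Comparing the colengths of a m^(n+1) = a K m^n = b J m^n for large n gives
   l(R/J) = l(R/K) + l(m^(n+1)/J m^n).

   (b) As R/m is infinite, some w in K generates a reduction of m, so the
   multiplicity is l(R/wR) = l(R/K) + l(K/wR). Since w is a minimal generator of
   K, l(K/wR) = r(R) - 1 + l((mK + wR)/wR), and the last term vanishes if and
   only if m(K/wR) = 0. *)

Set Implicit Arguments.
Unset Strict Implicit.
Unset Printing Implicit Defensive.

Import Order.TTheory GRing.Theory Num.Theory.

Local Open Scope classical_set_scope.
Local Open Scope ring_scope.

(** * Submodules, chains and lengths *)

(** Length is handled as the relative length [haslen A B n] of B/A inside one ambient module. A map
    of subquotients is then a function that is linear modulo a submodule, additivity is a statement
    about chains, and the suprema in [\bar rat] are met only at finite values. Noetherianity is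
    known for ideals only. Nakayama's lemma for ideals, Baer's criterion and finiteness of colength
    are therefore obtained by choosing a maximal ideal in a family; finite generation of a canonical
    module serves only to make a lift surjective. No long exact sequence of Ext and no ring of
    fractions is set up. Ext^1(R/m, N) is identified with the socle of N/xN cocycle by cocycle, for
    any resolution, and the fraction a/b appears through the equation b h(k) = a k alone. What makes
    the injectivity arguments possible is that only m-primary ideals matter: they reduce to R/m by
    adjoining one socle element at a time. *)

Section Submodules.
Variables (R : comNzRingType) (V : lmodType R).
Implicit Types (A B C N : submodClosed V) (P : V -> Prop).

Lemma sub0 N : 0 \in N.
Proof. exact: rpred0. Qed.

Lemma subD N u v : u \in N -> v \in N -> u + v \in N.
Proof. exact: rpredD. Qed.

Lemma subN N u : u \in N -> - u \in N.
Proof. by move=> uN; rewrite -scaleN1r; exact: rpredZ. Qed.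

Lemma subB N u v : u \in N -> v \in N -> u - v \in N.
Proof. by move=> uN vN; apply: subD => //; exact: subN. Qed.

Lemma subZ N a u : u \in N -> a *: u \in N.
Proof. exact: rpredZ. Qed.

Lemma sub_congr N u v : u - v \in N -> v \in N -> u \in N.
Proof. by move=> uv vN; rewrite -(subrK v u) subD. Qed.

Lemma sub_congrC N u v : u - v \in N -> v - u \in N.
Proof. by move=> /subN; rewrite opprB. Qed.

Lemma sub_sum N (I : Type) (r : seq I) (Q : pred I) (F : I -> V) :
  (forall i, Q i -> F i \in N) -> \sum_(i <- r | Q i) F i \in N.
Proof. by move=> H; apply: (big_ind (fun v => v \in N)) => //; [exact: sub0|exact: subD]. Qed.

Definition submodule_prop P :=
  P 0 /\ forall a u v, P u -> P v -> P (a *: u + v).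

Definition prop_pred P : {pred V} := fun v => `[< P v >].

Fact prop_pred_closed P : submodule_prop P -> submod_closed (prop_pred P).
Proof.
case=> P0 PD; split=> [|a u v /asboolP Pu /asboolP Pv]; apply/asboolP => //.
exact: PD.
Qed.

(** Opaque on purpose: a submodule built from a predicate is used through [mksubP] and never by
    unfolding the packed structure. *)
Lemma mksub_exists P : submodule_prop P ->
  {N : submodClosed V | forall v, v \in N <-> P v}.
Proof.
move=> HP; pose N : submodClosed V :=
  HB.pack (prop_pred P) (GRing.isSubmodClosed.Build R V
    (prop_pred P) (GRing.submod_closed_semi (prop_pred_closed HP))).
exists N => v.
by split=> [/asboolP|?]; last apply/asboolP.
Qed.

Definition mksub P (HP : submodule_prop P) : submodClosed V :=
  sval (mksub_exists HP).

Lemma mksubP P (HP : submodule_prop P) v : v \in mksub HP <-> P v.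
Proof. exact: (svalP (mksub_exists HP)). Qed.

Fact zero_sub_prop : submodule_prop (fun v => v = 0).
Proof. by split=> // a u v -> ->; rewrite scaler0 addr0. Qed.
Definition zero_sub := mksub zero_sub_prop.
Lemma zero_subP v : v \in zero_sub <-> v = 0.
Proof. exact: mksubP. Qed.

Fact full_sub_prop : submodule_prop (fun=> True).
Proof. by []. Qed.
Definition full_sub := mksub full_sub_prop.
Lemma full_subP v : v \in full_sub.
Proof. exact/mksubP. Qed.

Fact cap_sub_prop A B : submodule_prop (fun v => v \in A /\
   v \in B).
Proof.
split; first by split; exact: sub0.
by move=> a u v [? ?] [? ?]; split; apply: subD => //; exact: subZ.
Qed.
Definition cap_sub A B := mksub (cap_sub_prop A B).
Lemma cap_subP A B v : v \in cap_sub A B <-> v \in A /\ v \in B.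
Proof. exact: mksubP. Qed.

Fact add_sub_prop A B : submodule_prop
  (fun v => exists a b, [/\ a \in A,
     b \in B & v = a + b]).
Proof.
split; first by exists 0, 0; rewrite addr0; split=> //; exact: sub0.
move=> r _ _ [a [b [aA bB ->]]] [a' [b' [aA' bB' ->]]].
exists (r *: a + a'), (r *: b + b'); split; try by apply: subD => //; exact: subZ.
by rewrite scalerDr addrACA.
Qed.
Definition add_sub A B := mksub (add_sub_prop A B).
Lemma add_subP A B v : v \in add_sub A B <->
  exists a b, [/\ a \in A, b \in B & v = a + b].
Proof. exact: mksubP. Qed.

Lemma add_subl A B : {subset A <= add_sub A B}.
Proof. by move=> v vA; apply/add_subP; exists v, 0; rewrite addr0; split=> //; exact: sub0. Qed.

Lemma add_subr A B : {subset B <= add_sub A B}.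
Proof. by move=> v vA; apply/add_subP; exists 0, v; rewrite add0r; split=> //; exact: sub0. Qed.

Lemma add_sub_min A B C : {subset A <= C} -> {subset B <= C} ->
  {subset add_sub A B <= C}.
Proof. by move=> sAC BC _ /add_subP[a [b [/sAC ? /BC ? ->]]]; exact: subD. Qed.

Fact line_sub_prop t : submodule_prop (fun v => exists r : R, v = r *: t).
Proof.
split; first by exists 0; rewrite scale0r.
by move=> a _ _ [r ->] [s ->]; exists (a * r + s); rewrite scalerDl scalerA.
Qed.
Definition line_sub t := mksub (line_sub_prop t).
Lemma line_subP t v : v \in line_sub t <-> exists r : R, v = r *: t.
Proof. exact: mksubP. Qed.
Lemma line_sub_id t : t \in line_sub t.
Proof. by apply/line_subP; exists 1; rewrite scale1r. Qed.
Lemma line_sub_min t C : t \in C -> {subset line_sub t <= C}.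
Proof. by move=> tC _ /line_subP[r ->]; exact: subZ. Qed.

(** The submodule A : I. For I = m and A = xV, its quotient by xV is the socle of V/xV. *)
Fact colon_sub_prop (I : ideal R) A :
  submodule_prop (fun v => forall a : R, a \in I -> a *: v \in A).
Proof.
split=> [a _|r u v Hu Hv a aI]; first by rewrite scaler0 sub0.
rewrite scalerDr scalerA mulrC -scalerA; apply: subD; last exact: Hv.
by apply: subZ; exact: Hu.
Qed.
Definition colon_sub I A := mksub (colon_sub_prop I A).
Lemma colon_subP (I : ideal R) A v :
  v \in colon_sub I A <-> (forall a : R, a \in I -> a *: v \in A).
Proof. exact: mksubP. Qed.

Lemma scale_imageP x v : v \in scale_image x V <-> exists u, v = x *: u.
Proof. by split=> [/asboolP|?]; last apply/asboolP. Qed.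

Lemma submod_valZ N a (u : submod N) : val (a *: u) = a *: val u.
Proof. by []. Qed.

Lemma submod_val_sum N n (F : 'I_n -> submod N) :
  val (\sum_i F i) = \sum_i val (F i).
Proof. exact: raddf_sum. Qed.

End Submodules.


Section Annihilator.
Variables (R : comNzRingType) (V : lmodType R).

Fact ann_sub_prop (M A : submodClosed V) :
  submodule_prop (fun r : R^o => forall v, v \in M -> (r : R) *: v \in A).
Proof.
split=> [v _|r u v Hu Hv w wM]; first by rewrite scale0r sub0.
by rewrite scalerDl -scalerA; apply: subD; [apply: subZ; exact: Hu|exact: Hv].
Qed.
Definition ann_sub M A : ideal R := mksub (ann_sub_prop M A).
Lemma ann_subP (M A : submodClosed V) (r : R) :
  r \in ann_sub M A <-> (forall v, v \in M -> r *: v \in A).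
Proof. exact: (mksubP (ann_sub_prop M A) r). Qed.

End Annihilator.

Section HomMod.
Variables (R : comNzRingType) (V W : lmodType R).

(* That is, [h] induces a linear map [B -> W/D]. *)
Definition hommod (B : submodClosed V) (D : submodClosed W) (h : V -> W) :=
  forall r u v, u \in B -> v \in B -> h (r *: u + v) - (r *: h u + h v) \in D.

Variables (B : submodClosed V) (D : submodClosed W) (h : V -> W).
Hypothesis hB : hommod B D h.

Lemma hommod0 : h 0 \in D.
Proof.
have := hB 1 (sub0 B) (sub0 B); rewrite !scale1r addr0 opprD addrA subrr add0r.
by move=> /subN; rewrite opprK.
Qed.

Lemma hommodB u v : u \in B -> v \in B -> h (u - v) - (h u - h v) \in D.
Proof.
move=> uB vB; have := hB (-1) vB uB.
by rewrite !scaleN1r ![- _ + _]addrC.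
Qed.

Lemma hommod_sub (B' : submodClosed V) : {subset B' <= B} -> hommod B' D h.
Proof. by move=> BB r u v /BB uB /BB vB; exact: hB. Qed.

(** This is h(B) + D, the preimage in W of the image of the induced map B -> W/D. *)
Fact hommod_image_prop : submodule_prop
  (fun w => exists2 v, v \in B & w - h v \in D).
Proof.
split; first by exists 0; [exact: sub0|rewrite sub0r subN ?hommod0].
move=> r w w' [v vB wv] [v' vB' wv'].
exists (r *: v + v'); first by apply: subD => //; exact: subZ.
rewrite -(subrKA (r *: h v + h v')); apply: subD.
  by have := subD (subZ r wv) wv'; rewrite scalerBr addrACA -opprD.
exact: sub_congrC (hB r vB vB').
Qed.
Definition hommod_image := mksub hommod_image_prop.
Lemma hommod_imageP w : w \in hommod_image <-> exists2 v, v \in B & w - h v \in D.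
Proof. exact: mksubP. Qed.

Fact hommod_preim_prop (N : submodClosed W) (DN : {subset D <= N}) :
  submodule_prop (fun v => v \in B /\ h v \in N).
Proof.
split; first by split; [exact: sub0|exact/DN/hommod0].
move=> r u v [uB uN] [vB vN]; split; first by apply: subD => //; exact: subZ.
apply: sub_congr (DN _ (hB r uB vB)) _.
by apply: subD => //; exact: subZ.
Qed.
Definition hommod_preim N DN := mksub (@hommod_preim_prop N DN).
Lemma hommod_preimP N DN v : v \in @hommod_preim N DN <-> v \in B /\ h v \in N.
Proof. exact: mksubP. Qed.

End HomMod.

(** * Relative length by strict chains *)

Section Chains.
Variables (R : comNzRingType) (V : lmodType R).
Implicit Types A B C D : submodClosed V.

(** The bottom term has only to contain [A], so chains survive shrinking [A] and enlarging [B]. The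
    number n in [haslen A B n] is the length of B/A. *)
Fixpoint chain A B n : Prop :=
  if n is n'.+1 then exists2 C, chain A C n' & strict_subset C B
  else {subset A <= B}.

Definition haslen A B n := chain A B n /\ ~ chain A B n.+1.

Lemma strict_sub_trans A B C :
  strict_subset A B -> {subset B <= C} -> strict_subset A C.
Proof.
move=> [AB nBA] BC; split=> [v /AB/BC //|CA]; apply: nBA => v /BC/CA //.
Qed.

Lemma strict_subP A B : {subset A <= B} ->
  {subset B <= A} \/ strict_subset A B.
Proof. by move=> AB; case: (pselect {subset B <= A}) => ?; [left|right]. Qed.

Lemma not_subP A B : ~ {subset B <= A} -> exists2 v, v \in B & v \notin A.
Proof.
move=> nBA; apply: contrapT => H; apply: nBA => v vB.
by apply: contrapT => /negP vA; apply: H; exists v.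
Qed.

Lemma chain_widen A B C n : {subset B <= C} -> chain A B n -> chain A C n.
Proof.
case: n => [|n] BC /= => [AB v /AB/BC //|[D AD DB]].
by exists D => //; exact: strict_sub_trans BC.
Qed.

Lemma chain_sub A B n : chain A B n -> {subset A <= B}.
Proof.
elim: n B => [|n IH] B //= [C /IH sAC [CB _]] v /sAC/CB //.
Qed.

Lemma chain_leq A B n p : (p <= n)%N -> chain A B n -> chain A B p.
Proof.
elim: n B p => [|n IH] B [|p] // pn; first by move=> /chain_sub.
by move=> /= [C sAC CB]; exists C => //; exact: IH sAC.
Qed.

Lemma chain_cat A B C p q : chain A B p -> chain B C q -> chain A C (p + q).
Proof.
move=> AB; elim: q C => [|q IH] C /=.
  by rewrite addn0 => BC; exact: chain_widen AB.
by rewrite addnS => -[D /IH AD DC]; exists D.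
Qed.

(** Intersecting a chain with [C] and adding [C] to it keeps every step strict on at least one side:
    by the modular law, N inside D is D once it has the same intersection and the same sum with C.
    Additivity of length rests on this. *)
Lemma chain_split A C D p : {subset A <= C} -> chain A D p ->
  exists p1 p2, [/\ (p <= p1 + p2)%N, chain A (cap_sub C D) p1 &
    chain C (add_sub C D) p2].
Proof.
move=> sAC; elim: p D => [|p IH] D /=.
  move=> AD; exists 0%N, 0%N; split=> //=; last exact: add_subl.
  by move=> v vA; apply/cap_subP; split; [exact: sAC|exact: AD].
move=> [N /IH[p1 [p2 [pp c1 c2]]] [ND nDN]].
have s1 : {subset cap_sub C N <= cap_sub C D}.
  by move=> v /cap_subP[vC /ND vD]; apply/cap_subP.
have s2 : {subset add_sub C N <= add_sub C D}.
  by apply: add_sub_min => [v vC|v /ND vD]; [exact: add_subl|exact: add_subr].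
have [e1|l1] := strict_subP s1; last first.
  exists p1.+1, p2; split; first by rewrite addSn ltnS.
    by exists (cap_sub C N).
  exact: chain_widen c2.
have [e2|l2] := strict_subP s2; last first.
  exists p1, p2.+1; split; first by rewrite addnS ltnS.
    exact: chain_widen c1.
  by exists (add_sub C N).
case: nDN => v vD.
have /e2/add_subP[c [n [cC nN vE]]] : v \in add_sub C D by exact: add_subr.
have /e1/cap_subP[_ cN] : c \in cap_sub C D.
  apply/cap_subP; split=> //; have -> : c = v - n by rewrite vE addrK.
  by apply: subB => //; exact: ND.
by rewrite vE subD.
Qed.

Lemma haslen_sub A B n : haslen A B n -> {subset A <= B}.
Proof. by case=> /chain_sub. Qed.

Lemma haslen_leq A B n p : haslen A B n -> chain A B p -> (p <= n)%N.
Proof.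
move=> [_ nc] c; rewrite leqNgt; apply/negP => np; apply: nc.
exact: chain_leq c.
Qed.

Lemma haslen_uniq A B n p : haslen A B n -> haslen A B p -> n = p.
Proof.
move=> H1 H2; apply/eqP; rewrite eqn_leq.
by rewrite (haslen_leq H1 H2.1) (haslen_leq H2 H1.1).
Qed.

Lemma haslen_bounded A B n : {subset A <= B} -> ~ chain A B n.+1 ->
  exists2 p, (p <= n)%N & haslen A B p.
Proof.
move=> AB; elim: n => [|n IH] nc; first by exists 0%N => //; split.
case: (pselect (chain A B n.+1)) => [c|/IH[p pn hp]]; first by exists n.+1.
by exists p => //; exact: leqW.
Qed.

Lemma chain_bound_cat A B C p q : {subset A <= B} -> {subset B <= C} ->
  ~ chain A B p.+1 -> ~ chain B C q.+1 -> ~ chain A C (p + q).+1.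
Proof.
move=> AB BC n1 n2 /(chain_split AB)[p1 [p2 [le c1 c2]]].
have l1 : (p1 <= p)%N.
  rewrite leqNgt; apply/negP => /chain_leq H; apply: n1.
  by apply: H; apply: chain_widen c1 => v /cap_subP[].
have l2 : (p2 <= q)%N.
  rewrite leqNgt; apply/negP => /chain_leq H; apply: n2.
  by apply: H; apply: chain_widen c2; exact: add_sub_min.
by move: le; rewrite leqNgt ltnS leq_add.
Qed.

Lemma haslen_cat A B C p q : haslen A B p -> haslen B C q ->
  haslen A C (p + q).
Proof.
move=> h1 h2; split; first exact: chain_cat h1.1 h2.1.
by apply: chain_bound_cat (haslen_sub h1) (haslen_sub h2) h1.2 h2.2.
Qed.

Lemma haslen_split A B C n : {subset A <= B} -> {subset B <= C} ->
  haslen A C n -> exists p q, [/\ haslen A B p, haslen B C q & n = (p + q)%N].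
Proof.
move=> AB BC h.
have [|p _ hp] := @haslen_bounded A B n AB.
  by move=> c; apply: h.2; exact: chain_widen c.
have [|q _ hq] := @haslen_bounded B C n BC.
  by move=> c; have := chain_cat (AB : chain A B 0) c; exact: h.2.
by exists p, q; split=> //; exact: haslen_uniq h (haslen_cat hp hq).
Qed.

Lemma haslen0 A B : {subset A <= B} -> {subset B <= A} -> haslen A B 0.
Proof.
by move=> AB BA; split=> //= -[C sAC [CB nBC]]; apply: nBC => v /BA/sAC.
Qed.

Lemma haslen0_sub A B : haslen A B 0 -> {subset B <= A}.
Proof.
move=> [/= AB nc]; apply: contrapT => nBA; apply: nc.
by exists A => //; split.
Qed.

Lemma haslen_eq A B A' B' n : A =i A' -> B =i B' ->
  haslen A B n -> haslen A' B' n.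
Proof.
move=> AA BB h.
have sA : {subset A' <= A} by move=> v; rewrite AA.
have sA' : {subset A <= A'} by move=> v; rewrite AA.
have sB : {subset B' <= B} by move=> v; rewrite BB.
have sB' : {subset B <= B'} by move=> v; rewrite BB.
have := haslen_cat (haslen_cat (haslen0 sA sA') h) (haslen0 sB' sB).
by rewrite add0n addn0.
Qed.

End Chains.

Section Transport.
Variables (R : comNzRingType) (V W : lmodType R).
Variables (A B : submodClosed V) (A' B' : submodClosed W) (h : V -> W).
Hypothesis hB : hommod B A' h.

(** Injectivity of B/A -> B'/A' keeps images strict; in [chain_pull] surjectivity does the same for
    preimages. *)
Lemma chain_push n : {subset A' <= B'} ->
  (forall v, v \in B -> h v \in B') ->
  (forall v, v \in B -> h v \in A' -> v \in A) ->
  chain A B n -> chain A' B' n.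
Proof.
move=> AB' hBB' hA c.
suff: forall (N : submodClosed _) (NB : {subset N <= B}), chain A N n ->
    chain A' (hommod_image (hommod_sub hB NB)) n.
  move=> /(_ B (fun _ => id) c); apply: chain_widen => w /hommod_imageP[v vB].
  by move=> /AB' wv; apply: sub_congr wv _; exact: hBB'.
elim: n {c} => [|n IH] N NB /=.
  by move=> _ w wA; apply/hommod_imageP; exists 0; [exact: sub0|
    apply: subB => //; exact: hommod0 hB].
move=> [C sAC [CN nNC]].
have CB : {subset C <= B} by move=> v /CN/NB.
exists (hommod_image (hommod_sub hB CB)); first exact: IH.
split=> [w /hommod_imageP[v /CN vN wv]|]; first by apply/hommod_imageP; exists v.
have [t tN tC] := not_subP nNC; move=> /(_ (h t)) H.
have /H/hommod_imageP[v vC] : h t \in hommod_image (hommod_sub hB NB).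
  by apply/hommod_imageP; exists t => //; rewrite subrr sub0.
move=> {H} htv; case/negP: tC; apply: (@sub_congr _ _ _ _ v) => //.
apply: (chain_sub sAC); apply: hA; first by apply: subB; [exact: NB|exact: CB].
by apply: sub_congr htv; apply: hommodB hB _ _ _ _; [exact: NB|exact: CB].
Qed.

Lemma chain_pull n : {subset A <= B} ->
  (forall v, v \in A -> h v \in A') ->
  (forall w, w \in B' -> exists2 v, v \in B & w - h v \in A') ->
  chain A' B' n -> chain A B n.
Proof.
move=> AB hA surj c.
suff: forall (N : submodClosed _) (NB : {subset N <= B'}) (c : chain A' N n),
    chain A (hommod_preim hB (chain_sub c)) n.
  move=> /(_ B' (fun _ => id) c); apply: chain_widen => v /hommod_preimP[] //.
elim: n {c} => [|n IH] N NB /= c.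
  by move=> v vA; apply/hommod_preimP; split; [exact: AB|exact/c/hA].
have [C c' [CN nNC]] := c; have CB : {subset C <= B'} by move=> v /CN/NB.
exists (hommod_preim hB (chain_sub c')); first exact: IH.
split=> [v /hommod_preimP[vB /CN vN]|H]; first exact/hommod_preimP.
apply: (nNC) => w wN; have [v vB wv] := surj _ (NB _ wN).
have wvC : w - h v \in C by exact: chain_sub c' _ wv.
have /H/hommod_preimP[_ vC] :
    v \in hommod_preim hB (@chain_sub _ _ A' N n.+1 c).
  apply/hommod_preimP; split=> //; apply: sub_congr wN.
  by apply: sub_congrC; exact: CN.
exact: sub_congr wvC vC.
Qed.

Definition subquotient_iso := [/\ {subset A' <= B'}, {subset A <= B},
  forall v, v \in B -> h v \in B',
  forall v, v \in B -> (h v \in A') = (v \in A) &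
  forall w, w \in B' -> exists2 v, v \in B & w - h v \in A'].

Lemma haslen_iso n : subquotient_iso -> haslen A B n <-> haslen A' B' n.
Proof.
move=> [AB' AB hBB' hA surj].
have h1 p : chain A B p -> chain A' B' p.
  by apply: chain_push => // v vB; rewrite hA.
have h2 p : chain A' B' p -> chain A B p.
  by apply: chain_pull => // v vA; rewrite hA //; exact: AB.
by split=> -[c nc]; split; auto.
Qed.

End Transport.

(* [ereal_sup] over [rat] is only meaningful when a supremum exists. *)
Lemma ereal_sup_nat_ubound (P : nat -> Prop) n : P n ->
  (n%:R%:E <= ereal_sup [set k%:R%:E | k in [set k | P k]] :> \bar rat)%E.
Proof.
move=> Pn; apply: ge_supremum_Nmem; last by exists n.
case: (pselect (exists M, forall k, P k -> (k <= M)%N)) => [[M HM]|unb].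
  have exP : exists k, `[< P k >] by exists n; exact/asboolP.
  have ubP k : `[< P k >] -> (k <= M)%N by move=> Pk; apply: HM; exact/asboolP.
  case: (ex_maxnP exP ubP) => k /asboolP Pk kmax.
  exists k%:R%:E; split=> [_ [j Pj <-]|y]; last by move=> Hy; apply: Hy; exists k.
  by rewrite lee_fin ler_nat; apply: kmax; exact/asboolP.
(* An unbounded set of naturals has supremum +oo, since a rational upper bound would give an
   integral one. *)
exists +oo%E; split=> [x _|]; first exact: leey.
case=> [r||] // Hr; last by have := Hr _ (ex_intro2 _ _ n Pn erefl).
case: unb; exists (Num.truncn r).+1 => k Pk.
have : (k%:R%:E <= r%:E :> \bar rat)%E by apply: Hr; exists k.
rewrite lee_fin => /le_lt_trans/(_ (truncnS_gt r)).
by rewrite ltr_nat; exact: ltnW.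
Qed.

Section Length.
Variables (R : comNzRingType).

Lemma chainP (V : lmodType R) n : chain (zero_sub V) (full_sub V) n <->
  exists N : nat -> submodClosed V,
      forall i, (i < n)%N -> strict_subset (N i) (N i.+1).
Proof.
split; last first.
  move=> [N HN]; apply: (chain_widen (B := N n)) => [v _|]; first exact: full_subP.
  elim: n HN => [|n IH] HN /=; first by move=> v /zero_subP ->; exact: sub0.
  by exists (N n); [apply: IH => i lin; apply: HN; exact: leqW|exact: HN].
suff H : forall B, chain (zero_sub V) B n -> exists2 N : nat -> submodClosed V,
   N n = B & forall i, (i < n)%N -> strict_subset (N i) (N i.+1).
  by move=> /H[N _ HN]; exists N.
elim: n => [|n IH] B /=; first by exists (fun=> B).
move=> [C /IH[N NC HN] CB]; exists (fun i => if (i <= n)%N then N i else B).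
  by rewrite ltnn.
move=> i lin; rewrite -ltnS lin; case: ltnP => [lin'|nin]; first exact: HN.
by rewrite (_ : i = n) ?NC //; apply/eqP; rewrite eqn_leq nin -ltnS lin.
Qed.

Lemma length_haslen (V : lmodType R) n :
  haslen (zero_sub V) (full_sub V) n -> length V = n%:R%:E.
Proof.
move=> h; apply/eqP; rewrite eq_le; apply/andP; split.
  apply: ge_ereal_sup => _ [p Hp <-]; rewrite lee_fin ler_nat.
  by apply: haslen_leq h _; exact/chainP.
by apply: ereal_sup_nat_ubound; apply/chainP; case: h.
Qed.

Lemma length1_haslen (V : lmodType R) : length V = 1%:E ->
  haslen (zero_sub V) (full_sub V) 1.
Proof.
move=> V1; split; last first.
  move=> /chainP c; have : (2%:R%:E <= length V)%E.
    exact: ereal_sup_nat_ubound c.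
  by rewrite V1 lee_fin -[X in _ <= X]/(1%:R) ler_nat.
apply: contrapT => nc; have : (length V <= 0%:E)%E.
  apply: ge_ereal_sup => _ [p Hp <-]; rewrite lee_fin.
  case: p Hp => [|p] Hp //; case: nc; apply: (@chain_leq _ _ _ _ p.+1) => //.
  exact/chainP.
by rewrite V1 lee_fin -[X in X <= _]/(1%:R) -[X in _ <= X]/(0%:R) ler_nat.
Qed.

Lemma linear_function (U V : lmodType R) (f : U -> V) : linear f ->
  {g : {linear U -> V} | g =1 f}.
Proof.
move=> lf; pose g : {linear U -> V} :=
  HB.pack f (GRing.isLinear.Build R U V *:%R f lf).
by exists g.
Qed.

Lemma quotmod_pi_linear (V : lmodType R) (N : submodClosed V) :
  linear (quotmod_pi N).
Proof. by move=> r u v; rewrite quotmod_piD -quotmod_scale_pi. Qed.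

Lemma quotmod_pi0P (V : lmodType R) (N : submodClosed V) v :
  quotmod_pi N v = 0 <-> v \in N.
Proof.
have p0 : quotmod_pi N 0 = 0.
  have := quotmod_pi_linear N 1 0 0; rewrite !scale1r addr0.
  by move=> /eqP; rewrite eq_sym -subr_eq0 addrK => /eqP.
rewrite -p0 -{2}[v]subr0; split=> [/eqP|?]; first by rewrite quotmod_piE.
by apply/eqP; rewrite quotmod_piE.
Qed.

Lemma haslen_quotmod (V : lmodType R) (N : submodClosed V) n :
  haslen N (full_sub V) n <-> haslen (zero_sub (quotmod N)) (full_sub _) n.
Proof.
have hpi : hommod (full_sub V) (zero_sub _) (@quotmod_pi _ _ N).
  by move=> r u v _ _; apply/zero_subP; rewrite quotmod_pi_linear subrr.
apply: (haslen_iso hpi); split.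
- by move=> v _; exact: full_subP.
- by move=> v _; exact: full_subP.
- by move=> v _; exact: full_subP.
- by move=> v _; apply/idP/idP => [/zero_subP/quotmod_pi0P|/quotmod_pi0P/zero_subP].
- move=> w _; exists (repr w : V); first exact: full_subP.
  by rewrite -{1}(quotmod_piK w) subrr sub0.
Qed.

Lemma length_quotmod (V : lmodType R) (N : submodClosed V) n :
  haslen N (full_sub V) n -> length (quotmod N) = n%:R%:E.
Proof. by move=> /haslen_quotmod/length_haslen. Qed.

End Length.

(** * Noetherian local rings of dimension one *)

Section Ideals.
Variable R : comNzRingType.
Implicit Types (I J C L : ideal R) (a b r x : R).

Lemma idealM I a b : b \in I -> a * b \in I.
Proof. by move=> bI; exact: (@subZ R R^o I a b bI). Qed.

Lemma idealMr I a b : a \in I -> a * b \in I.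
Proof. by rewrite mulrC; exact: idealM. Qed.

Lemma idealD I a b : a \in I -> b \in I -> a + b \in I.
Proof. exact: (@subD R R^o I a b). Qed.

Lemma ideal_lineP a x : x \in (line_sub (a : R^o) : ideal R) <->
  exists r, x = r * a.
Proof. exact: (line_subP (a : R^o) x). Qed.

Lemma in_ideal_mul I J a b : a \in I -> b \in J -> a * b \in ideal_mul I J.
Proof.
move=> aI bJ; apply/asboolP; exists [:: (a, b)]; rewrite big_seq1; split=> // p.
by rewrite inE => /eqP ->.
Qed.

Lemma ideal_mul_min I J C : (forall a b, a \in I -> b \in J -> a * b \in C) ->
  {subset ideal_mul I J <= C}.
Proof.
move=> H x /asboolP[s [sIJ ->]]; rewrite big_seq.
by apply: (@sub_sum R R^o) => p /sIJ[pI pJ]; exact: H.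
Qed.

Lemma ideal_mulS I J I' J' : {subset I <= I'} -> {subset J <= J'} ->
  {subset ideal_mul I J <= ideal_mul I' J'}.
Proof.
by move=> II JJ; apply: ideal_mul_min => a b /II aI /JJ bJ; exact: in_ideal_mul.
Qed.

Lemma ideal_mul_subr I J : {subset ideal_mul I J <= J}.
Proof. by apply: ideal_mul_min => a b _; exact: idealM. Qed.

Lemma ideal_mulAr I J L :
  {subset ideal_mul I (ideal_mul J L) <= ideal_mul (ideal_mul I J : ideal R) L}.
Proof.
apply: ideal_mul_min => a b aI.
suff H : {subset ideal_mul J L <=
    ann_sub (line_sub (a : R^o)) (ideal_mul (ideal_mul I J : ideal R) L)}.
  by move=> /H/ann_subP/(_ _ (line_sub_id _)); rewrite [_ *: _]mulrC.
apply: ideal_mul_min => c d cJ dL; apply/ann_subP => _ /line_subP[r ->].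
rewrite [_ *: _](_ : _ = (r * a * c) * d); last by rewrite [LHS]mulrC !mulrA.
by apply: in_ideal_mul => //; apply: in_ideal_mul => //; exact: idealM.
Qed.

Lemma ideal_mulAl I J L :
  {subset ideal_mul (ideal_mul I J : ideal R) L <= ideal_mul I (ideal_mul J L)}.
Proof.
apply: ideal_mul_min => x d xIJ dL; move: x xIJ.
suff H : {subset ideal_mul I J <=
    ann_sub (line_sub (d : R^o)) (ideal_mul I (ideal_mul J L : ideal R))}.
  by move=> x /H/ann_subP/(_ _ (line_sub_id _)).
apply: ideal_mul_min => a b aI bJ; apply/ann_subP => _ /line_subP[r ->].
rewrite [_ *: _](_ : _ = a * (b * (r * d))); last exact: esym (mulrA _ _ _).
by apply: in_ideal_mul => //; apply: in_ideal_mul => //; exact: idealM.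
Qed.

Lemma ideal_mulC I J : {subset ideal_mul I J <= ideal_mul J I}.
Proof.
by apply: ideal_mul_min => a b aI bJ; rewrite mulrC; exact: in_ideal_mul.
Qed.

Lemma ideal_expD I p q :
  {subset ideal_exp I (p + q) <= ideal_mul (ideal_exp I p) (ideal_exp I q)}.
Proof.
elim: p => [|p IH] x; first by rewrite add0n => xI; rewrite -[x]mul1r in_ideal_mul.
rewrite addSn => xI; apply: ideal_mulAr.
by apply: ideal_mulS xI => // y /IH.
Qed.

Lemma ideal_exp_mulD I p q a b : a \in ideal_exp I p -> b \in ideal_exp I q ->
  a * b \in ideal_exp I (p + q).
Proof.
elim: p a => [|p IH] a; first by move=> _; rewrite add0n; exact: idealM.
rewrite addSn => + bq; move: a.
suff H : {subset ideal_mul I (ideal_exp I p) <=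
    ann_sub (line_sub (b : R^o)) (ideal_exp I (p + q).+1)}.
  by move=> a /H/ann_subP/(_ _ (line_sub_id _)).
apply: ideal_mul_min => a c aI cp; apply/ann_subP => _ /line_subP[r ->].
rewrite [_ *: _](_ : _ = a * (r * (c * b))); last first.
  exact: etrans (esym (mulrA a c (r * b))) (congr1 _ (mulrCA c r b)).
by apply: in_ideal_mul => //; apply: idealM; exact: IH.
Qed.

Lemma ideal_expS_sub I n : {subset ideal_exp I n.+1 <= ideal_exp I n}.
Proof. exact: ideal_mul_subr. Qed.

Lemma ideal_exp_leq I n p : (p <= n)%N ->
  {subset ideal_exp I n <= ideal_exp I p}.
Proof.
move=> /subnK <-; elim: (n - p)%N => [|k IH] x //.
by rewrite addSn => /ideal_expS_sub/IH.
Qed.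

Lemma ideal_exp1 I x : x \in ideal_exp I 1 <-> x \in I.
Proof.
split=> [|xI]; last by rewrite -[x]mulr1; exact: in_ideal_mul.
by apply: ideal_mul_min => a b aI _; exact: idealMr.
Qed.

Lemma expr_ideal_exp I a n : a \in I -> a ^+ n \in ideal_exp I n.
Proof.
by move=> aI; elim: n => [|n IH] //; rewrite exprS; exact: in_ideal_mul.
Qed.

Lemma reductionS_ge J I : reduction J I ->
  exists n0, forall n, (n0 <= n)%N ->
    ideal_exp I n.+1 =i ideal_mul J (ideal_exp I n).
Proof.
move=> [JI [n0 Hn0]]; exists n0 => n /subnKC <-.
elim: (n - n0)%N => [|k IH] x; first by rewrite addn0.
rewrite addnS; apply/idP/idP; last exact: ideal_mulS.
move=> H; have : x \in ideal_mul I (ideal_mul J (ideal_exp I (n0 + k)) : ideal R).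
  by apply: ideal_mulS H => // y; rewrite -IH.
move=> /ideal_mulAr; move: x {H}; apply: ideal_mul_min => y d yIJ dI.
have /ideal_mulAl : y * d \in ideal_mul (ideal_mul J I : ideal R) (ideal_exp I (n0 + k)).
  by apply: in_ideal_mul => //; exact: ideal_mulC.
by [].
Qed.

Definition regular a := forall r, a * r = 0 -> r = 0.

Lemma regularX a n : regular a -> regular (a ^+ n).
Proof.
move=> ra; elim: n => [|n IH] r; first by rewrite mul1r.
by rewrite exprS -mulrA => /ra/IH.
Qed.

Lemma regular_neq0 a : regular a -> a != 0.
Proof.
move=> ra; apply/eqP => a0; have /ra/eqP : a * 1 = 0 by rewrite a0 mul0r.
by rewrite oner_eq0.
Qed.

Lemma regular_inj a r s : regular a -> a * r = a * s -> r = s.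
Proof. by move=> ra e; apply/eqP; rewrite -subr_eq0; apply/eqP/ra; rewrite mulrBr e subrr. Qed.

End Ideals.

Section Noetherian.
Variable R : comNzRingType.
Hypothesis noethR : noetherian R.

(** Without a maximal member, choice yields a strictly increasing sequence of ideals. Its union is
    finitely generated, and the generators already lie in one term. *)
Lemma ideal_max (Q : ideal R -> Prop) (I0 : ideal R) : Q I0 ->
  exists I, [/\ Q I, {subset I0 <= I} &
    forall J : ideal R, Q J -> {subset I <= J} -> {subset J <= I}].
Proof.
move=> QI0; apply: contrapT => nmax.
pose T := {I : ideal R | Q I /\ {subset I0 <= I}}.
have step (I : T) : exists J : T, strict_subset (sval I) (sval J).
  case: I => I [QI II0] /=; apply: contrapT => nJ; apply: nmax.
  exists I; split=> // J QJ IJ; apply: contrapT => nJI; apply: nJ.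
  have J0 : Q J /\ {subset I0 <= J} by split=> // v /II0/IJ.
  by exists (exist _ J J0); split.
have [f Hf] := choice step.
pose I n := sval (iter n f (exist _ I0 (conj QI0 (fun _ => id)) : T)).
have IS n : strict_subset (I n) (I n.+1) by exact: Hf.
have Ile n p : (p <= n)%N -> {subset I p <= I n}.
  move=> /subnK <-; elim: (n - p)%N => [|k IH] x // /IH.
  by rewrite addSn; exact: (IS _).1.
have UP : submodule_prop (fun x : R^o => exists n, x \in I n).
  split; first by exists 0%N; exact: sub0.
  move=> a u v [p up] [q vq]; exists (maxn p q); apply: subD.
    by apply: subZ; apply: Ile up; exact: leq_maxl.
  by apply: Ile vq; exact: leq_maxr.
pose U : ideal R := mksub UP.
have [s Hs] := noethR U.
have [n Hn] : exists n, forall i, (i < size s)%N -> val s`_i \in I n.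
  elim: {Hs} s => [|t s [n Hn]]; first by exists 0%N.
  have [p tp] : exists p, val t \in I p by apply/(mksubP UP); exact: (valP t).
  exists (maxn p n) => -[|i] /= si; first by apply: Ile tp; exact: leq_maxl.
  by apply: Ile (Hn _ si); exact: leq_maxr.
apply: (IS n).2 => x xI.
have xU : x \in U by apply/(mksubP UP); exists n.+1.
have [c xE] := Hs (Sub x xU); have -> : x = val (Sub x xU : submod U) by [].
rewrite xE submod_val_sum; apply: (@sub_sum R R^o) => i _.
rewrite submod_valZ; apply: subZ; exact: Hn.
Qed.

Lemma fg_ideal_ind (I : ideal R) : exists s : seq R,
  (forall a, a \in s -> a \in I) /\
  forall J : ideal R, (forall a, a \in s -> a \in J) -> {subset I <= J}.
Proof.
have [s Hs] := noethR I; exists [seq val v | v <- s]; split.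
  by move=> _ /mapP[v _ ->]; exact: (valP v).
move=> J HJ x xI; have [c xE] := Hs (Sub x xI).
have -> : x = val (Sub x xI : submod I) by [].
rewrite xE submod_val_sum; apply: (@sub_sum R R^o) => i _.
rewrite submod_valZ; apply: subZ; apply: HJ; apply: map_f; exact: mem_nth.
Qed.

Lemma ideal_to_prime (P : ideal R) : 1 \notin P ->
  (forall a b : R, a * b \in P -> a \in P \/ b \in P) ->
  exists P' : prime_idealr R, P' =i P.
Proof.
move=> P1 Pp; pose S : {pred R} := fun x => x \in P.
have cl : idealr_closed S.
  split=> [||a u v uP vP]; [exact: sub0|exact: P1|].
  exact: (@subD R R^o P _ _ (subZ a uP) vP).
have pr : prime_idealr_closed S.
  by move=> a b /Pp[aP|bP]; apply/orP; [left|right].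
pose P' : prime_idealr R := HB.pack S (isIdealr.Build R S cl)
  (isPrimeIdealrClosed.Build R S pr).
by exists P'.
Qed.


(** An ideal above [I] that is maximal among those disjoint from the multiplicative set [S] is
    prime. This stands in for localization. *)
Lemma prime_avoid (S : R -> Prop) (I : ideal R) :
  S 1 -> (forall a b, S a -> S b -> S (a * b)) ->
  (forall a, S a -> a \notin I) ->
  exists P : ideal R, [/\ {subset I <= P}, forall a, S a -> a \notin P &
    forall a b : R, a * b \in P -> a \in P \/ b \in P].
Proof.
move=> S1 SM SI.
have [P [SP IP Pmax]] := ideal_max (Q := fun J => forall a, S a -> a \notin J) SI.
exists P; split=> // a b abP; apply: contrapT => /not_orP[aP bP].
have meet c : ~ c \in P -> exists s r, S s /\ s - r * c \in P.
  move=> cP; apply: contrapT => nm; apply: (cP).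
  apply: (Pmax (add_sub P (line_sub (c : R^o)))) => [s Ss||]; first last.
  - by apply: add_subr; exact: line_sub_id.
  - exact: add_subl.
  apply/negP => /add_subP[p [_ [pP /line_subP[r ->] sE]]].
  by apply: nm; exists s, r; split=> //; rewrite sE [_ *: _]/(r * c) addrK.
have [s [r [Ss sr]]] := meet a aP; have [s' [r' [Ss' sr']]] := meet b bP.
have /negP := SP _ (SM _ _ Ss Ss'); apply.
have -> : s * s' = (s - r * a) * s' + r * a * (s' - r' * b) + r * r' * (a * b).
  by rewrite mulrBl mulrBr [r * a * (_ * _)]mulrACA addrA !subrK.
apply: idealD; last exact: idealM.
by apply: idealD; [exact: idealMr|exact: idealM].
Qed.



End Noetherian.

(** * Nakayama's lemma and finite colength in a local ring *)

Section Local.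
Variables (R : comNzRingType) (m : ideal R).
Hypotheses (noethR : noetherian R) (locR : local_ring m).
Implicit Types (I J L A : ideal R) (a b r x : R).

Lemma max_notin1 : 1 \notin m.
Proof. by case: locR => -[]. Qed.

Lemma proper_sub_max I : 1 \notin I -> {subset I <= m}.
Proof.
move=> I1; have [M [M1 IM Mmax]] := ideal_max noethR (Q := fun J => 1 \notin J) I1.
have /locR.2 E : maximal_ideal M by split=> // J J1 MJ; exact: Mmax.
by move=> x /IM; rewrite E.
Qed.

Lemma unit_of_notin r : r \notin m -> exists s, s * r = 1.
Proof.
move=> rm; apply: contrapT => nu; case/negP: rm.
apply: (@proper_sub_max (line_sub (r : R^o))); last exact: line_sub_id.
by apply/negP => /line_subP[s sE]; apply: nu; exists s.
Qed.

Lemma notin_of_unit r s : s * r = 1 -> r \notin m.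
Proof. by move=> e; apply/negP => rm; case/negP: max_notin1; rewrite -e idealM. Qed.

Lemma max_prime a b : a * b \in m -> a \in m \/ b \in m.
Proof.
move=> ab; case: (boolP (a \in m)) => [|/unit_of_notin[s sa]]; first by left.
by right; rewrite -[b]mul1r -sa -mulrA idealM.
Qed.

Lemma unit_1B a : a \in m -> exists s, s * (1 - a) = 1.
Proof.
move=> am; apply: unit_of_notin; apply/negP => H; case/negP: max_notin1.
by rewrite -(subrK a 1) idealD.
Qed.

Lemma sub_unitZ (V : lmodType R) (N : submodClosed V) r v :
  r \notin m -> r *: v \in N -> v \in N.
Proof.
by move=> /unit_of_notin[s sr] /(subZ s); rewrite scalerA sr scale1r.
Qed.

(** Take L above [N], maximal among the ideals not containing [I], and t in [I] outside L. By
    maximality [I] lies in L + yR for each y outside L; for y = a t with a in m, the unit 1 - r a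
    would put t into L. So m t lies in L, then m I lies in m(L + tR) and hence in L, and finally [I]
    lies in L. *)
Lemma nakayama_ideal I N :
  {subset I <= (add_sub N (ideal_mul m I : ideal R) : ideal R)} ->
  {subset I <= (N : ideal R)}.
Proof.
move=> H; apply: contrapT => nIN.
pose Q L := {subset N <= L} /\ ~ {subset I <= L}.
have [L [[NL nIL] _ Lmax]] := ideal_max noethR (Q := Q) (conj (fun _ => id) nIN).
have [t tI tL] := not_subP nIL.
have big x : x \notin L -> {subset I <= (add_sub L (line_sub (x : R^o)) : ideal R)}.
  move=> xL; apply: contrapT => nI; case/negP: xL.
  apply: (Lmax (add_sub L (line_sub (x : R^o)))).
  - by split=> // y /NL; exact: add_subl.
  - exact: add_subl.
  - by apply: add_subr; exact: line_sub_id.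
have mt a : a \in m -> a * t \in L.
  move=> am; apply: contrapT => /negP /big /(_ t tI).
  move=> /add_subP[l [_ [lL /line_subP[r ->] tE]]].
  case/negP: tL; have [s sE] := unit_1B (idealM r am).
  rewrite -[t]mul1r -sE -mulrA; apply: idealM.
  have -> : (1 - r * a) * t = t - r * (a * t) by rewrite mulrBl mul1r mulrA.
  by rewrite {1}tE [_ *: _]/(r * (a * t)) addrK.
apply: nIL => x /H /add_subP[n [w [/NL nL + ->]]].
move=> wI; apply: idealD => //; move: w wI; apply: ideal_mul_min => a b am bI.
have /add_subP[l [_ [lL /line_subP[r ->] ->]]] := big t tL b bI.
rewrite mulrDr; apply: idealD; first exact: idealM.
by rewrite [_ *: _]/(r * t) mulrCA; apply: idealM; exact: mt.
Qed.

Lemma nakayama_mod (V : lmodType R) (N : submodClosed V) x : x \in m ->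
  finitely_generated V ->
  (forall v, exists2 n, n \in N & exists w, v = n + x *: w) ->
  forall v, v \in N.
Proof.
move=> xm [s Hs] H.
(* Generators are eliminated one at a time: modulo N each is a combination of all of them with
   coefficients in m, and the unit 1 - c 0 solves the first equation for the head of the list. *)
suff gen : forall (s : seq V), (forall i, (i < size s)%N ->
    exists2 n, n \in N & exists2 c : nat -> R, forall j, c j \in m &
      s`_i = n + \sum_(j < size s) c j *: s`_j) ->
    forall i, (i < size s)%N -> s`_i \in N.
  have sN i : (i < size s)%N -> s`_i \in N.
    apply: gen => j _; have [n nN [w ->]] := H s`_j; exists n => //.
    have [c ->] := Hs w; exists (fun k => x * c k) => [k|]; first exact: idealMr.
    by congr (_ + _); rewrite scaler_sumr; apply: eq_bigr => k _; rewrite scalerA.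
  by move=> v; have [c ->] := Hs v; apply: sub_sum => i _; apply: subZ; exact: sN.
move=> {s Hs H}; elim=> [|t s IH] //= H.
have [n nN [c cm /=]] := H 0%N isT; rewrite big_ord_recl /= => tE.
have [u uE] := unit_1B (cm 0%N).
have {}tE : t = u *: n + \sum_(j < size s) (u * c j.+1) *: s`_j.
  have -> : t = u *: ((1 - c 0%N) *: t) by rewrite scalerA uE scale1r.
  rewrite scalerBl scale1r {1}tE addrCA addrAC subrr add0r scalerDr scaler_sumr.
  by congr (_ + _); apply: eq_bigr => j _; rewrite scalerA.
have sN i : (i < size s)%N -> s`_i \in N.
  apply: IH => {}i si; have [p pN [d dm /=]] := H i.+1 si.
  rewrite big_ord_recl /= => ->.
  exists (p + d 0%N *: (u *: n)); first by apply: subD => //; do 2!apply: subZ.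
  exists (fun j => d 0%N * (u * c j.+1) + d j.+1) => [j|].
    by apply: idealD; [exact: idealMr|exact: dm].
  rewrite {1}tE scalerDr -!addrA; congr (_ + (_ + _)).
  rewrite scaler_sumr -big_split; apply: eq_bigr => j _ /=.
  by rewrite scalerDl scalerA.
case=> [_|i]; last exact: sN.
rewrite /= tE; apply: subD; first exact: subZ.
by apply: sub_sum => j _; apply: subZ; exact: sN.
Qed.

Section SimpleStep.
Variable V : lmodType R.
Implicit Types B C D : submodClosed V.

(** With n least such that m^n C lies in [B], a product r v outside [B] with r in m^(n-1) is killed
    by m modulo [B]. *)
Lemma simple_step B C n : (forall r v, r \in ideal_exp m n -> v \in C -> r *: v \in B) ->
  ~ {subset C <= B} ->
  exists t, [/\ t \in C, t \notin B & forall a, a \in m -> a *: t \in B].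
Proof.
elim: n => [|n IH] H nCB.
  by case: nCB => v vC; rewrite -[v]scale1r; exact: H.
case: (pselect (forall r v, r \in ideal_exp m n -> v \in C -> r *: v \in B)).
  by move=> /IH; apply.
move=> /existsNP[r /existsNP[v /not_implyP[rm /not_implyP[vC /negP rv]]]].
exists (r *: v); split=> // [|a am]; first exact: subZ.
by rewrite scalerA; apply: H => //; exact: in_ideal_mul.
Qed.

Lemma haslen_step B t : t \notin B -> (forall a, a \in m -> a *: t \in B) ->
  haslen B (add_sub B (line_sub t)) 1.
Proof.
move=> tB mt; have ht : t \in add_sub B (line_sub t).
  by apply: add_subr; exact: line_sub_id.
split.
  exists B => //; split; first exact: add_subl.
  by move=> H; case/negP: tB; exact: H.
move=> [C [D DB [DC nDC]] [CB nCB]]; apply: nCB.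
have [v vC vD] := not_subP nDC.
have /CB/add_subP[b [_ [bB /line_subP[r ->] vE]]] := vC.
have tC : t \in C.
  apply: (@sub_unitZ _ _ r).
    apply/negP => /mt rt; case/negP: vD; rewrite vE.
    by apply: subD; exact: DB.
  have -> : r *: t = v - b by rewrite vE addrC addKr.
  by apply: subB => //; apply: DC; exact: DB.
apply: add_sub_min; last exact: line_sub_min.
by move=> w /DB/DC.
Qed.

End SimpleStep.

(** Take J maximal among the counterexamples above [I]. Adding a socle element of R/J gives an ideal
    of finite colength, and J lies one step below it. *)
Lemma haslen_quotient I n : {subset ideal_exp m n <= I} ->
  exists l, haslen I (full_sub _) l.
Proof.
move=> mI; apply: contrapT => nl.
pose Q J := {subset I <= J} /\ ~ exists l, haslen J (full_sub _) l.
have [J [[IJ nJ] _ Jmax]] := ideal_max noethR (Q := Q) (conj (fun _ => id) nl).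
have [||t [_ tJ mt]] := @simple_step R^o J (full_sub _) n.
- by move=> r v rm _; rewrite [_ *: _]mulrC; apply/idealM/IJ/mI.
- move=> fJ; apply: nJ; exists 0%N; apply: haslen0 => // v _; exact: full_subP.
have hs := haslen_step tJ mt.
apply: nJ; case: (pselect (exists l, haslen (add_sub J (line_sub t)) (full_sub _) l)).
  by move=> [l hl]; exists (1 + l)%N; exact: haslen_cat hs hl.
move=> nJt; case/negP: tJ; apply: (Jmax (add_sub J (line_sub t))).
- by split=> // x /IJ; exact: add_subl.
- exact: add_subl.
- by apply: add_subr; exact: line_sub_id.
Qed.

End Local.

Section DimensionOne.
Variables (R : comNzRingType) (m : ideal R).
Hypotheses (noethR : noetherian R) (locR : local_ring m).
Hypothesis dimR : krull_dim R = 1%:E.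

(** The products s x^n with s outside [P] form a multiplicative set, without 0 because [x] is
    regular. A prime Q avoiding it lies in [P] and misses [x]; were [P] not m, the chain Q, P, m
    would contradict dimension one. *)
Lemma prime_regular_max (P : ideal R) (x : R) : regular x -> x \in P ->
  1 \notin P -> (forall a b : R, a * b \in P -> a \in P \/ b \in P) ->
  {subset m <= P}.
Proof.
move=> rx xP P1 Pp; apply: contrapT => nmP.
pose S (a : R) := exists s n, s \notin P /\ a = s * x ^+ n.
have [||a [s [n [sP ->]]]|Q [_ SQ Qp]] := @prime_avoid _ noethR S (zero_sub _).
- by exists 1, 0%N; rewrite mulr1.
- move=> _ _ [s [n [sP ->]]] [s' [n' [sP' ->]]].
  exists (s * s'), (n + n')%N; rewrite exprD mulrACA; split=> //.
  by apply/negP => /Pp[]; exact/negP.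
- apply/negP => /zero_subP; rewrite mulrC => /(regularX rx) s0.
  by case/negP: sP; rewrite s0 sub0.
have Q1 : 1 \notin Q by apply: SQ; exists 1, 0%N; rewrite mulr1.
have QP : {subset Q <= P}.
  move=> y yQ; apply: contrapT => /negP yP.
  by have /negP[] := SQ y (ex_intro _ y (ex_intro _ 0%N (conj yP (esym (mulr1 y))))).
have xQ : x \notin Q by apply: SQ; exists 1, 1%N; rewrite mul1r.
have [p0 E0] := ideal_to_prime Q1 Qp.
have [p1 E1] := ideal_to_prime P1 Pp.
have [p2 E2] := ideal_to_prime (max_notin1 locR) (max_prime noethR locR).
have : (2%:R%:E <= krull_dim R)%E.
  apply: ereal_sup_nat_ubound.
  exists (fun i => match i with 0%N => p0 | 1%N => p1 | _ => p2 end) => -[|[|]] //= _.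
    split=> [y|H]; first by rewrite E0 E1; exact: QP.
    by case/negP: xQ; rewrite -E0; apply: H; rewrite E1.
  split=> [y|H]; first by rewrite E1 E2; exact: (proper_sub_max noethR locR P1).
  by apply: nmP => y ym; rewrite -E1; apply: H; rewrite E2.
by rewrite dimR lee_fin -[X in _ <= X]/(1%:R) ler_nat.
Qed.

(** An ideal L maximal among those containing [x] but no power of m is prime: if L + aR and L + bR
    contain m^p and m^q and a b is in L, then L contains m^(p+q). Being a prime with a regular
    element, L contains m after all. *)
Lemma regular_primary (x : R) : regular x -> x \in m ->
  exists n, {subset ideal_exp m n <= (line_sub (x : R^o) : ideal R)}.
Proof.
move=> rx xm; apply: contrapT => nm.
pose Q (L : ideal R) := {subset line_sub (x : R^o) <= L} /\
  ~ exists n, {subset ideal_exp m n <= (L : ideal R)}.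
have [L [[xL nL] _ Lmax]] := ideal_max noethR (Q := Q) (conj (fun _ => id) nm).
have big c : c \notin L -> exists n,
    {subset ideal_exp m n <= (add_sub L (line_sub (c : R^o)) : ideal R)}.
  move=> cL; apply: contrapT => nn; case/negP: cL.
  apply: (Lmax (add_sub L (line_sub (c : R^o)))).
  - by split=> // y /xL; exact: add_subl.
  - exact: add_subl.
  - by apply: add_subr; exact: line_sub_id.
apply: (nL); exists 1%N => y /ideal_exp1; move: y.
apply: (@prime_regular_max L x) => //.
- by apply: xL; exact: line_sub_id.
- apply/negP => L1; apply: nL; exists 0%N => y _.
  by rewrite -[y]mulr1; exact: idealM.
move=> a b ab; apply: contrapT => /not_orP[/negP/big[p Hp] /negP/big[q Hq]].
apply: nL; exists (p + q)%N => y /ideal_expD.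
apply: ideal_mul_min => {}y z /Hp/add_subP[l [_ [lL /line_subP[r ->] ->]]].
move=> /Hq/add_subP[l' [_ [lL' /line_subP[r' ->] ->]]].
rewrite [r *: _]/(r * a) [r' *: _]/(r' * b).
have -> : (l + r * a) * (l' + r' * b) = (l' + r' * b) * l + r * a * l' + r * r' * (a * b).
  by rewrite mulrDl [l * _]mulrC [r * a * (_ + _)]mulrDr [r * a * (_ * _)]mulrACA addrA.
by apply: idealD; [apply: idealD; exact: idealM|exact: idealM].
Qed.

End DimensionOne.

(** * Ext^1(R/m, -) *)

Definition nonzerodivisor (R : comNzRingType) (V : lmodType R) (x : R) :=
  forall v : V, x *: v = 0 -> v = 0.

Lemma nzd_inj (R : comNzRingType) (V : lmodType R) (x : R) (u v : V) :
  nonzerodivisor V x -> x *: u = x *: v -> u = v.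
Proof.
by move=> nx e; apply/eqP; rewrite -subr_eq0; apply/eqP/nx; rewrite scalerBr e subrr.
Qed.

Lemma exact_at_kernel (R : comNzRingType) (U V W : lmodType R)
  (f : {linear U -> V}) (g : {linear V -> W}) v :
  exact_at f g -> g v = 0 -> exists u, f u = v.
Proof.
move=> ex gv; have : [set y | g y = 0]%classic v by [].
by rewrite -ex => -[u _ <-]; exists u.
Qed.

Lemma exact_at_comp (R : comNzRingType) (U V W : lmodType R)
  (f : {linear U -> V}) (g : {linear V -> W}) u : exact_at f g -> g (f u) = 0.
Proof.
move=> ex; have : range f (f u) by exists u.
by rewrite ex.
Qed.

Lemma range_surj (T U : Type) (f : T -> U) u : range f = [set: U]%classic ->
  exists t, f t = u.
Proof. by move=> fT; have : [set: U]%classic u by []; rewrite -fT => -[t _ <-]; exists t. Qed.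

Section ExtResidue.
Variables (R : comNzRingType) (m : ideal R) (N : lmodType R) (x : R).
Variable F : projective_resolution (quotmod m).
Hypotheses (xm : x \in m) (nx : nonzerodivisor N x).

Let d0 := res_diff F 0%N.
Let aug := res_aug F.
Let xN : submodClosed N := scale_image x N.

Lemma residue_ann (a : R) (w : quotmod m) : a \in m -> a *: w = 0.
Proof.
move=> am; rewrite -[w]quotmod_piK [_ *: _]quotmod_scale_pi.
by apply/quotmod_pi0P; rewrite [_ *: _]mulrC; exact: idealM.
Qed.

(* Evaluation of a 1-cocycle at a preimage of [x *: p0], where [p0] lifts [1]. *)
Lemma ext1_residue l :
  haslen (zero_sub (Ext F N 1)) (full_sub _) l <->
  haslen xN (colon_sub m xN) l.
Proof.
have [p0 augp0] := range_surj (quotmod_pi m 1) (res_aug_surj F).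
have lift u : aug u = 0 -> exists y, d0 y = u.
  exact: exact_at_kernel (res_exact0 F).
have aug0 y : aug (d0 y) = 0 by exact: exact_at_comp (res_exact0 F).
have augZ (a : R) u : a \in m -> aug (a *: u) = 0.
  by move=> am; rewrite linearZ; exact: residue_ann.
have [y yE] := lift _ (augZ x p0 xm).
pose C := submod (cocycle (F := F) (N := N) (i := 1%N)).
have lin (f : C) : linear (val f) by have /asboolP[] := valP f.
have kil (f : C) u : val f (res_diff F 1 u) = 0 by have /asboolP[_ ->] := valP f.
have dep (f : C) u v : d0 u = d0 v -> val f u = val f v.
  have [g gE] := linear_function (lin f).
  move=> uv; suff : g (u - v) = 0.
    by rewrite linearB /= /= !gE => /eqP; rewrite subr_eq0 => /eqP.
  have [|w <-] := exact_at_kernel (v := u - v) (res_exactS F 0).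
    by rewrite linearB /=; apply/eqP; rewrite subr_eq0; exact/eqP.
  by rewrite gE kil.
have linZ (f : C) a u : val f (a *: u) = a *: val f u.
  by have [g gE] := linear_function (lin f); rewrite -!gE linearZ.
have linD (f : C) u v : val f (u + v) = val f u + val f v.
  by have [g gE] := linear_function (lin f); rewrite -!gE linearD.
pose h (f : C) := val f y.
have hh : hommod (full_sub C) xN h.
  by move=> r u v _ _; rewrite /h /= subrr sub0.
rewrite /Ext -haslen_quotmod; apply: (haslen_iso hh); split.
- move=> v /scale_imageP[u ->]. apply/colon_subP => a _; apply: subZ.
  by apply/scale_imageP; exists u.
- by move=> v _; exact: full_subP.
- move=> f _; apply/colon_subP => a am; apply/scale_imageP.
  have [ya yaE] := lift _ (augZ a p0 am); exists (val f ya).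
  rewrite -!linZ; apply: dep; rewrite !linearZ /= yE yaE !scalerA.
  by rewrite mulrC.
- move=> f _; apply/idP/idP => [/scale_imageP[n fy]|/asboolP[g gE]]; last first.
    by apply/scale_imageP; exists (g p0); rewrite /h gE -/d0 yE linearZ.
  (* The map g with x g(u) = f(z), where d0 z = x u, will bound f. As u is a multiple of p0 up to
     some d0 w, divisibility of f(y) by x gives that of f(z). *)
  have ex u : exists n', forall z, d0 z = x *: u -> val f z = x *: n'.
    have [r rE] : exists r : R, aug u = aug (r *: p0).
      exists (repr (aug u)); rewrite linearZ /= augp0 [_ *: _]quotmod_scale_pi.
      by rewrite [_ *: 1]mulr1 quotmod_piK.
    have [|w wE] := lift (u - r *: p0); first by rewrite linearB /= rE subrr.
    exists (r *: n + val f w) => z zE.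
    rewrite scalerDr scalerA mulrC -scalerA -fy /h -!linZ -linD; apply: dep.
    rewrite zE linearD /= !linearZ /= wE yE scalerBr !scalerA mulrC.
    by rewrite addrCA subrr addr0.
  have [g Hg] := choice ex.
  have gl : linear g.
    move=> a u v; apply: (nzd_inj nx); have [yu yuE] := lift _ (augZ x u xm).
    have [yv yvE] := lift _ (augZ x v xm).
    rewrite -(Hg _ (a *: yu + yv)); last first.
      by rewrite linearP /= yuE yvE scalerDr !scalerA mulrC.
    by rewrite linD linZ (Hg _ _ yuE) (Hg _ _ yvE) scalerDr !scalerA mulrC.
  have [g' g'E] := linear_function gl; apply/asboolP; exists g' => u.
  rewrite g'E; apply: (nzd_inj nx); rewrite -linZ; apply: Hg.
  by rewrite linearZ.
(* Projectivity lifts the augmentation to q : F 0 -> R. The cocycle sought sends u to q(d0 u) v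
   divided by x; at y it takes the value q(p0) v, which is v modulo xN. *)
- move=> v /colon_subP Hv.
  have [pi piE] := linear_function (quotmod_pi_linear m).
  have [|q qE] := @res_projective _ _ F 0%N _ _ pi aug.
    apply/seteqP; split=> // w _; exists (repr w) => //.
    by rewrite piE quotmod_piK.
  have qm u : q (d0 u) \in m.
    by apply/quotmod_pi0P; rewrite -piE qE aug0.
  have ex u : exists n, q (d0 u) *: v = x *: n.
    by apply/scale_imageP; exact: Hv.
  have [f Hf] := choice ex.
  have fl : linear f.
    move=> a u w; apply: (nzd_inj nx); rewrite scalerDr scalerA mulrC -scalerA.
    rewrite -!Hf; have -> : q (d0 (a *: u + w)) = a * q (d0 u) + q (d0 w).
      by rewrite !linearP.
    by rewrite scalerDl scalerA.
  have fc : f \in cocycle (F := F) (N := N) (i := 1%N).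
    apply/asboolP; split=> // u; apply: nx; rewrite -Hf.
    by rewrite /d0 (exact_at_comp _ (res_exactS F 0)) linear0 scale0r.
  exists (Sub f fc : C); first exact: full_subP.
  rewrite /h /=.
  have -> : f y = q p0 *: v.
    by apply: (nzd_inj nx); rewrite -Hf yE linearZ scalerA.
  rewrite -{1}[v]scale1r -scalerBl; apply: Hv.
  apply/quotmod_pi0P; by rewrite -piE linearB /= qE augp0 piE subrr.
Qed.

End ExtResidue.

Section LengthExt.
Variables (R : comNzRingType) (m : ideal R) (x : R).
Hypothesis xm : x \in m.

(** The nonzero value at [M] guarantees that R/m has a projective resolution; otherwise [length_Ext]
    would return its default 0. *)
Lemma length_Ext1_residue (M N : lmodType R) l :
  length_Ext 1 (quotmod m) M = 1%:E -> nonzerodivisor N x ->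
  haslen (scale_image x N : submodClosed N) (colon_sub m (scale_image x N)) l ->
  length_Ext 1 (quotmod m) N = l%:R%:E.
Proof.
rewrite /length_Ext => M1 nx hl.
have [F _] : exists F : projective_resolution (quotmod m),
    length (Ext F M 1) = 1%:E.
  move: M1; case: xgetP => [_ -> [F ->] F1|_ /eqP]; first by exists F.
  by rewrite eqe eq_sym oner_eq0.
have val (F' : projective_resolution (quotmod m)) : length (Ext F' N 1) = l%:R%:E.
  by apply: length_haslen; apply/(ext1_residue F' xm nx).
by apply: xget_unique => [|_ [F' ->]]; [exists F; rewrite val|exact: val].
Qed.

Lemma length_Ext1_residue1 (N : lmodType R) :
  length_Ext 1 (quotmod m) N = 1%:E -> nonzerodivisor N x ->
  haslen (scale_image x N : submodClosed N) (colon_sub m (scale_image x N)) 1.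
Proof.
rewrite /length_Ext => + nx.
case: xgetP => [_ -> [F ->]|_ /eqP]; last by rewrite eqe eq_sym oner_eq0.
by move=> /length1_haslen/(ext1_residue F xm nx).
Qed.

End LengthExt.

(** * Modules of finite injective dimension *)

Section LinearOn.
Variables (R : comNzRingType) (U W : lmodType R).
Implicit Types (I S : submodClosed U) (k g : U -> W).

(** A map defined on a submodule is kept as a total function, so that extending its domain changes
    no type. *)
Definition lin_on I k := forall (r : R) u v, u \in I -> v \in I ->
  k (r *: u + v) = r *: k u + k v.

Section Theory.
Variables (I : submodClosed U) (k : U -> W).
Hypothesis kI : lin_on I k.

Lemma lin_on0 : k 0 = 0.
Proof.
have := kI 1 (sub0 I) (sub0 I); rewrite !scale1r addr0 => /eqP.
by rewrite -subr_eq0 opprD addrA subrr add0r oppr_eq0 => /eqP.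
Qed.

Lemma lin_onZ r u : u \in I -> k (r *: u) = r *: k u.
Proof. by move=> uI; have := kI r uI (sub0 I); rewrite lin_on0 !addr0. Qed.

Lemma lin_onB u v : u \in I -> v \in I -> k (u - v) = k u - k v.
Proof.
by move=> uI vI; have := kI (-1) vI uI; rewrite !scaleN1r ![- _ + _]addrC.
Qed.

Lemma lin_on_sub S : {subset S <= I} -> lin_on S k.
Proof. by move=> SI r u v /SI uI /SI vI; exact: kI. Qed.

End Theory.

Lemma linear_on_graph I (P : U -> W -> Prop) :
  (forall u, u \in I -> exists w, P u w) ->
  (forall u w w', P u w -> P u w' -> w = w') ->
  (forall (r : R) u v w w', P u w -> P v w' -> P (r *: u + v) (r *: w + w')) ->
  exists k, lin_on I k /\ forall u, u \in I -> P u (k u).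
Proof.
move=> tot fn lin.
have ex u : exists w, u \in I -> P u w.
  by case: (boolP (u \in I)) => [/tot[w ?]|_]; [exists w|exists 0].
have [k Hk] := choice ex; exists k; split=> // r u v uI vI.
apply: fn (lin _ _ _ _ _ (Hk _ uI) (Hk _ vI)).
by apply: Hk; apply: subD => //; exact: subZ.
Qed.

(** Two decompositions of one element differ by a multiple of [t] lying in [S], where the hypothesis
    makes the two values agree. *)
Lemma lin_on_adjoin S g t z : lin_on S g ->
  (forall r : R, r *: t \in S -> g (r *: t) = r *: z) ->
  exists g', [/\ lin_on (add_sub S (line_sub t)) g',
    forall u, u \in S -> g' u = g u & g' t = z].
Proof.
move=> gS gt.
pose P u w := exists a (r : R), [/\ a \in S, u = a + r *: t & w = g a + r *: z].
have Pfun u w w' : P u w -> P u w' -> w = w'.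
  move=> [a [r [aS -> ->]]] [a' [r' [aS' e ->]]].
  have E : a - a' = (r' - r) *: t.
    by rewrite scalerBl; apply/eqP; rewrite subr_eq addrAC eq_sym subr_eq e addrC.
  have := gt (r' - r); rewrite -E (lin_onB gS) // => /(_ (subB aS aS')).
  rewrite scalerBl => /eqP; rewrite subr_eq addrAC eq_sym subr_eq => /eqP <-.
  by rewrite addrC.
have [||g' [g'L Pg]] := @linear_on_graph (add_sub S (line_sub t)) P _ Pfun.
- move=> u /add_subP[a [_ [aS /line_subP[r ->] ->]]].
  by exists (g a + r *: z), a, r.
- move=> r _ _ _ _ [a [s [aS -> ->]]] [a' [s' [aS' -> ->]]].
  exists (r *: a + a'), (r * s + s'); split.
  + by apply: subD => //; exact: subZ.
  + by rewrite scalerDr addrACA scalerDl scalerA.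
  + by rewrite gS // scalerDr addrACA scalerDl scalerA.
exists g'; split=> // [u uS|].
  apply: Pfun (Pg _ (add_subl _ uS)) _; exists u, 0.
  by rewrite !scale0r !addr0.
apply: Pfun (Pg _ (add_subr _ (line_sub_id t))) _; exists 0, 1.
by rewrite sub0 (lin_on0 gS) !scale1r !add0r.
Qed.

End LinearOn.

(** Baer's argument, with a maximal domain supplied by Noetherianity instead of Zorn's lemma: it is
    enough to know how to adjoin one element. *)
Lemma baer (R : comNzRingType) (noethR : noetherian R) (W : lmodType R)
    (N : submodClosed W) (I J : ideal R) (k : R^o -> W) :
  lin_on I k -> (forall a : R^o, a \in I -> k a \in N) -> {subset I <= J} ->
  (forall (S : ideal R) (g : R^o -> W), lin_on S g ->
    (forall a : R^o, a \in S -> g a \in N) -> {subset I <= S} ->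
    (forall a : R^o, a \in I -> g a = k a) -> {subset S <= J} -> ~ {subset J <= S} ->
    exists (t : R^o) z, [/\ t \in J, t \notin S, z \in N &
      forall r : R, r *: t \in S -> g (r *: t) = r *: z]) ->
  exists g : R^o -> W, [/\ lin_on J g, forall a : R^o, a \in J -> g a \in N &
    forall a : R^o, a \in I -> g a = k a].
Proof.
move=> kI kN IJ step.
pose Q (S : ideal R) := [/\ {subset I <= S}, {subset S <= J} & exists g : R^o -> W,
  [/\ lin_on S g, forall a : R^o, a \in S -> g a \in N &
    forall a : R^o, a \in I -> g a = k a]].
have QI : Q I by split=> //; exists k.
have [S [[IS SJ [g [gS gN gk]]] _ Smax]] := ideal_max noethR QI.
case: (pselect {subset J <= S}) => [JS|nJS].
  by exists g; split=> [|a /JS aS|]; [exact: lin_on_sub JS|exact: gN|].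
have [t [z [tJ tS zN gt]]] := step S g gS gN IS gk SJ nJS.
have [g' [g'L g'E g't]] := lin_on_adjoin gS gt.
case/negP: tS; apply: (Smax (add_sub S (line_sub t))).
- split; first by move=> a /IS; exact: add_subl.
    by apply: add_sub_min => //; exact: line_sub_min.
  exists g'; split=> // [_ /add_subP[a [_ [aS /line_subP[r ->] ->]]]|a aI].
    have aI : a \in add_sub S (line_sub t) by exact: add_subl.
    have tI : t \in add_sub S (line_sub t) by apply: add_subr; exact: line_sub_id.
    rewrite addrC g'L // g't g'E //; apply: subD; last exact: gN.
    exact: subZ.
  by rewrite g'E ?gk //; exact: IS.
- exact: add_subl.
- by apply: add_subr; exact: line_sub_id.
Qed.

Section Kernel.
Variables (R : comNzRingType) (U V : lmodType R) (f : {linear U -> V}).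

Fact ker_sub_prop : submodule_prop (fun u => f u = 0).
Proof. by split=> [|a u v fu fv]; rewrite ?linear0 // linearP fu fv scaler0 addr0. Qed.
Definition ker_sub := mksub ker_sub_prop.
Lemma ker_subP u : u \in ker_sub <-> f u = 0.
Proof. exact: mksubP. Qed.

End Kernel.

Section Injective.
Variables (R : comNzRingType) (E : lmodType R).
Hypothesis injE : injective_module E.

Lemma injective_ideal (I : ideal R) (k : R^o -> E) : lin_on I k ->
  exists e, forall a : R, a \in I -> k a = a *: e.
Proof.
move=> kI; have vl : linear (val : submod I -> R^o) by [].
have [g gE] := linear_function vl.
have kl : linear (fun u : submod I => k (val u)).
  by move=> r u v; rewrite -kI; [|exact: (valP u)|exact: (valP v)].
have [f fE] := linear_function kl.
have [|h hE] := injE f (g := g).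
  by move=> u v; rewrite !gE; exact: val_inj.
exists (h 1) => a aI; have := hE (Sub a aI).
rewrite fE gE /= => <-; rewrite -linearZ; congr (h _).
by rewrite [_ *: _]mulr1.
Qed.

Lemma injective_divisible (x : R) (e : E) : regular x -> exists e', e = x *: e'.
Proof.
move=> rx; have gl : linear (fun r : R^o => x * r : R^o).
  by move=> r u v; rewrite mulrDr /GRing.scale /= mulrCA.
have [g gE] := linear_function gl.
have fl : linear (fun r : R^o => (r : R) *: e).
  by move=> r u v; rewrite scalerDl -scalerA.
have [f fE] := linear_function fl.
have [|h hE] := injE f (g := g).
  by move=> u v; rewrite !gE; exact: regular_inj.
exists (h 1); rewrite -linearZ; have := hE 1.
by rewrite fE gE scale1r => <-; congr (h _).
Qed.

End Injective.

(** * Descent along an injective resolution *)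

Section InjectiveResolution.
Variables (R : comNzRingType) (m : ideal R) (x : R).
Hypotheses (noethR : noetherian R) (locR : local_ring m) (xm : x \in m).
Hypothesis rx : regular x.
Hypothesis px : exists n, {subset ideal_exp m n <= (line_sub (x : R^o) : ideal R)}.

Definition primary (I : ideal R) := exists n, {subset ideal_exp m n <= I}.

(** In other words, Ext^1(R/I, N) = 0 for every m-primary ideal I. *)
Definition primary_injective (W : lmodType R) (N : submodClosed W) :=
  forall (I : ideal R) (k : R^o -> W), primary I -> lin_on I k ->
    (forall a : R^o, a \in I -> k a \in N) ->
    exists2 z, z \in N & forall a : R, a \in I -> k a = a *: z.

Lemma socle_exists : exists s : R, s \notin (line_sub (x : R^o) : ideal R) /\
  forall a : R, a \in m -> a * s \in (line_sub (x : R^o) : ideal R).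
Proof.
have [n Hn] := px.
have [||s [_ sx ms]] := @simple_step R m R^o (line_sub (x : R^o)) (full_sub _) n.
- by move=> r v /Hn rx' _; rewrite [_ *: _]mulrC; exact: idealM.
- move=> /(_ 1 (full_subP _))/line_subP[r rE].
  by case/negP: (notin_of_unit locR (esym rE)).
by exists s; split.
Qed.

Lemma notin_maxP (S : ideal R) (t r : R) : t \notin S -> r * t \in S -> r \in m.
Proof.
move=> tS rt; apply: contrapT => /negP rm; case/negP: tS.
exact: (sub_unitZ noethR locR (V := R^o) rm).
Qed.

(** R/I is filtered by copies of R/m: for a socle element t of R/S, extending g from S to S + tR
    amounts to extending the map sending a to g(a t) from m to R. *)
Lemma primary_injective_max (W : lmodType R) (N : submodClosed W) :
  (forall k : R^o -> W, lin_on m k -> (forall a : R^o, a \in m -> k a \in N) ->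
    exists2 z, z \in N & forall a : R, a \in m -> k a = a *: z) ->
  primary_injective N.
Proof.
move=> H I k [n mI] kI kN.
have [|S g gS gN IS _ _ nS|g [gL gN gk]] :=
    @baer R noethR W N I (full_sub _) k kI kN; first by move=> y _; exact: full_subP.
  have [|t [_ tS mt]] := @simple_step R m R^o S (full_sub _) n _ nS.
    by move=> r v /mI/IS rS _; rewrite [_ *: _]mulrC; exact: idealM.
  have [||z zN zE] := H (fun a : R^o => g ((a : R) *: t)).
  - move=> r a b am bm; rewrite -gS; [|exact: mt|exact: mt].
    by rewrite scalerDl scalerA.
  - by move=> a /mt; exact: gN.
  exists t, z; split=> // [|r rt]; first exact: full_subP.
  by apply: zE; exact: notin_maxP rt.
exists (g 1); first by apply: gN; exact: full_subP.
move=> a aI; rewrite -gk // -(lin_onZ gL) ?full_subP //.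
by rewrite [_ *: _]mulr1.
Qed.

Section Descent.
Variables (E0 E1 E2 E3 : lmodType R).
Variables (dA : {linear E0 -> E1}) (dB : {linear E1 -> E2}) (dC : {linear E2 -> E3}).
Hypotheses (inj0 : injective_module E0) (inj1 : injective_module E1).
Hypotheses (exAB : exact_at dA dB) (exBC : exact_at dB dC).

(* The kernel of [dB] is divisible by [x], so that the [x]-torsion of [E1] maps
   onto the [x]-torsion of the kernel of [dC]; since [R/m] embeds into [R/xR],
   so does the [m]-torsion. *)
Lemma primary_injective_descent :
  primary_injective (ker_sub dC) -> primary_injective (ker_sub dB).
Proof.
move=> injC; apply: primary_injective_max => k km kB.
have div z : dB z = 0 -> exists2 z', dB z' = 0 & z = x *: z'.
  move=> /(exact_at_kernel exAB)[e <-].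
  have [e' ->] := injective_divisible inj0 e rx.
  by exists (dA e'); [exact: exact_at_comp exAB|rewrite linearZ].
have lift e' : dC e' = 0 -> x *: e' = 0 -> exists2 f, dB f = e' & x *: f = 0.
  move=> /(exact_at_kernel exBC)[e <-]; rewrite -linearZ => /div[z z0 zE].
  by exists (e - z); [rewrite linearB /= z0 subr0|rewrite scalerBr zE subrr].
have [e eE] := injective_ideal inj1 km.
have ke (a : R) : a \in m -> a *: dB e = 0.
  by move=> am; rewrite -linearZ -eE //; exact/ker_subP/kB.
have [s [sx ms]] := socle_exists.
have L0 : lin_on (line_sub (x : R^o)) (fun=> 0 : E2).
  by move=> r u v _ _; rewrite scaler0 addr0.
(* [s] spans a copy of R/m in R/xR, and m kills dB e, so x and s may be sent to 0 and dB e.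
   Extending this map to R gives z with s z = dB e and x z = 0. *)
have [|k' [k'L k'x k's]] := @lin_on_adjoin R R^o E2 _ _ (s : R^o) (dB e) L0.
  by move=> r rs; rewrite ke //; exact: notin_maxP rs.
have [|||z zC zE] := injC (add_sub (line_sub (x : R^o)) (line_sub (s : R^o))) k'.
- by have [n Hn] := px; exists n => y /Hn; exact: add_subl.
- exact: k'L.
- move=> _ /add_subP[a [_ [ax /line_subP[r ->] ->]]]; apply/ker_subP.
  rewrite addrC k'L; last by exact: add_subl.
    by rewrite k's k'x // addr0 linearZ /= (exact_at_comp _ exBC) scaler0.
  by apply: add_subr; exact: line_sub_id.
have sz : s *: z = dB e.
  by rewrite -zE ?k's //; apply: add_subr; exact: line_sub_id.
have xz : x *: z = 0.
  by rewrite -zE ?k'x //; [|apply: add_subl]; exact: line_sub_id.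
have [f fz xf] := lift z ((ker_subP _ _).1 zC) xz.
(* dB sends s f to s z = dB e. For a in m the product a s is in xR and x kills f, so the correction
   does not disturb the values on m. *)
exists (e - s *: f); first by apply/ker_subP; rewrite linearB linearZ /= fz sz subrr.
move=> a am; rewrite scalerBr eE // scalerA.
have /ideal_lineP[r ->] := ms a am.
by rewrite -scalerA xf scaler0 subr0.
Qed.

End Descent.

(* Ext^1(I, C) = 0 for [m]-primary ideals [I], in the form: maps [I -> C/xC]
   lift to [C]. *)
Definition liftable (C : lmodType R) := forall (I : ideal R)
  (k : R^o -> quotmod (scale_image x C)), primary I -> lin_on I k ->
  exists h : R^o -> C, lin_on I h /\
    forall a : R^o, a \in I -> quotmod_pi (scale_image x C) (h a) = k a.

(** For the first cosyzygy ker(d 1), Ext^1(R/I, ker(d 1)) is Ext^2(R/I, C), that is Ext^1(I, C):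
    this group holds the obstruction to lifting along C -> C/xC. *)
Lemma finite_injective_dimension_liftable (C : lmodType R) :
  nonzerodivisor C x -> finite_injective_dimension C -> liftable C.
Proof.
move=> nx [n [E [d [eta [injE E0 injeta ex0 exS]]]]].
(* Descending induction on i with j = n - i; for i = n the kernel sits inside E n.+1, which is
   zero. *)
have pinj j : forall i, (i.+1 + j = n.+1)%N -> primary_injective (ker_sub (d i.+1)).
  elim: j => [|j IH] i; rewrite ?addn0 => ij.
    move=> I k _ _ _; exists 0 => [|a _]; first exact: sub0.
    by rewrite scaler0; apply: E0; rewrite ij.
  apply: (primary_injective_descent (dA := d i) (dC := d i.+2)) => //.
  by apply: IH; rewrite addSnnS.
have {}pinj := pinj n 0%N (erefl _).
move=> I k pI kI.
pose pi := quotmod_pi (scale_image x C).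
have piP c : pi c = 0 -> exists c', c = x *: c'.
  by move=> /quotmod_pi0P/scale_imageP.
have piL : linear pi := @quotmod_pi_linear _ _ _.
have piB c c' : pi (c - c') = pi c - pi c'.
  by have [p pE] := linear_function piL; rewrite -!pE linearB.
have pix c : pi (x *: c) = 0 by apply/quotmod_pi0P/scale_imageP; exists c.
have gl : linear (fun c : C => (0, x *: c) : R^o * C).
  move=> r u v; congr pair => /=; first by rewrite scaler0 addr0.
  by rewrite scalerDr !scalerA mulrC.
have [g gE] := linear_function gl.
(* H divides by x: it sends (0, x c) to eta c. Hence d 0 (H(a, c)), for c a lift of k(a), does not
   depend on c; this is the obstruction [kap]. *)
have [|H HE] := injE 0%N _ _ g eta.
  by move=> u v; rewrite !gE => -[] /(nzd_inj nx).
have {}HE c : H (0, x *: c) = eta c by rewrite -HE gE.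
have H0 c : pi c = 0 -> exists2 c', c = x *: c' & H (0, c) = eta c'.
  by move=> /piP[c' ->]; exists c'.
have HB a c c' : H (a, c) - H (a, c') = H (0, c - c').
  by rewrite -linearB; congr (H _); congr pair; rewrite /= subrr.
pose kap (a : R^o) := d 0%N (H (a, repr (k a) : C)).
have kapE (a : R^o) c : pi c = k a -> d 0%N (H (a, c)) = kap a.
  move=> ca; apply/eqP; rewrite -subr_eq0 -linearB /= HB.
  have [|c' _ ->] := H0 (c - (repr (k a) : C)); last by rewrite (exact_at_comp _ ex0).
  by rewrite piB ca /pi quotmod_piK subrr.
have kapI : lin_on I kap.
  move=> r a b aI bI.
  rewrite -(kapE (r *: a + b) (r *: (repr (k a) : C) + repr (k b))); last first.
    by rewrite piL /pi !quotmod_piK kI.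
  by rewrite /kap -!linearP.
have [z /ker_subP zK zE] := pinj I kap pI kapI
  (fun a _ => (ker_subP _ _).2 (exact_at_comp _ (exS 0%N))).
have [e eE] := exact_at_kernel (exS 0%N) zK.
(* As kap a = a d 0 (e), the element H(a, c) - a e comes from some c1 in C. Replacing c by c + x c0
   replaces c1 by c1 + c0, so c - x c1 is independent of the lift. *)
pose P (a : R^o) (c' : C) := exists c c1,
  [/\ pi c = k a, a \in I, H (a, c) = (a : R) *: e + eta c1 & c' = c - x *: c1].
have [|||h [hI Ph]] := @linear_on_graph R R^o C I P.
- move=> a aI; pose c : C := repr (k a).
  have [|c1 c1E] := exact_at_kernel (v := H (a, c) - (a : R) *: e) ex0.
    by rewrite linearB linearZ /= eE -zE // /kap subrr.
  exists (c - x *: c1), c, c1; split=> //; first by rewrite /pi quotmod_piK.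
  by rewrite c1E addrC subrK.
- move=> a _ _ [c [c1 [ca aI E1 ->]]] [c' [c1' [ca' _ E1' ->]]].
  have [|c0 c0E HcE] := H0 (c - c'); first by rewrite piB ca ca' subrr.
  move: HcE; rewrite -(HB a) E1 E1' opprD addrACA subrr add0r -linearB => /injeta e1.
  have -> : c = c' + x *: c1 - x *: c1'.
    by rewrite -[c](subrK c') c0E -e1 scalerBr addrC addrA.
  by rewrite addrAC addrK.
- move=> r a b _ _ [c [c1 [ca aI E1 ->]]] [c' [c1' [ca' bI E1' ->]]].
  exists (r *: c + c'), (r *: c1 + c1'); split.
  + by rewrite piL ca ca' kI.
  + by apply: subD => //; exact: subZ.
  + have -> : H (r *: a + b, r *: c + c') = r *: H (a, c) + H (b, c').
      by rewrite -linearP.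
    rewrite E1 E1' [eta (_ + _)]linearP [(_ + _ : R) *: e]scalerDl scalerDr scalerA.
    by rewrite addrACA.
  + by rewrite [x *: (_ + _)]scalerDr scalerBr opprD addrACA !scalerA mulrC.
exists h; split=> // a aI; have [c [c1 [ca _ _ ->]]] := Ph a aI.
by rewrite -/pi piB ca pix subr0.
Qed.

End InjectiveResolution.

(** * Duality modulo a regular element *)

Section ScaleSub.
Variables (R : comNzRingType) (V : lmodType R) (a : R) (N : submodClosed V).

Fact scale_sub_prop : submodule_prop (fun v => exists2 u, u \in N & v = a *: u).
Proof.
split; first by exists 0; rewrite ?scaler0 ?sub0.
move=> r _ _ [u uN ->] [v vN ->]; exists (r *: u + v).
  by apply: subD => //; exact: subZ.
by rewrite scalerDr !scalerA mulrC.
Qed.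
Definition scale_sub := mksub scale_sub_prop.
Lemma scale_subP v : v \in scale_sub <-> exists2 u, u \in N & v = a *: u.
Proof. exact: mksubP. Qed.

Lemma scale_sub_sub : {subset scale_sub <= N}.
Proof. by move=> _ /scale_subP[u uN ->]; exact: subZ. Qed.

End ScaleSub.

Lemma scale_idealP (R : comNzRingType) (a : R) (I : ideal R) (x : R) :
  x \in (scale_sub a I : ideal R) <-> exists2 u : R, u \in I & x = a * u.
Proof. exact: (scale_subP a I). Qed.

Lemma haslen_scale (R : comNzRingType) (V : lmodType R) (a : R)
  (A B : submodClosed V) n : nonzerodivisor V a -> {subset A <= B} ->
  haslen A B n <-> haslen (scale_sub a A) (scale_sub a B) n.
Proof.
move=> ra AB; have H : hommod B (scale_sub a A) (fun v => a *: v).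
  by move=> r u v _ _; rewrite scalerDr !scalerA mulrC subrr sub0.
apply: (haslen_iso H); split=> //.
- by move=> _ /scale_subP[u /AB uB ->]; apply/scale_subP; exists u.
- by move=> v vB; apply/scale_subP; exists v.
- move=> v vB; apply/idP/idP => [/scale_subP[u uA /(nzd_inj ra) ->] //|vA].
  by apply/scale_subP; exists v.
- by move=> _ /scale_subP[u uB ->]; exists u => //; rewrite subrr sub0.
Qed.

(** The colength of xK is computed through xR and through K; the equal lengths of xR/xK and R/K
    cancel. *)
Lemma haslen_scale_ideal (R : comNzRingType) (x : R) (K : ideal R) n k :
  regular x -> haslen K (full_sub R^o) k ->
  haslen (line_sub (x : R^o)) (full_sub _) n -> haslen (scale_sub x K) K n.
Proof.
move=> rx hK hx; have nxR : nonzerodivisor R^o x := rx.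
have full_x : scale_sub x (full_sub R^o) =i line_sub (x : R^o).
  move=> v; apply/idP/idP => [/scale_idealP[u _ ->]|/ideal_lineP[r ->]].
    by rewrite mulrC; apply/ideal_lineP; exists u.
  by apply/scale_idealP; exists r; [exact: full_subP|exact: mulrC].
have KF : {subset K <= full_sub R^o} by move=> v _; exact: full_subP.
have h1 := haslen_eq (fun=> erefl) full_x ((haslen_scale _ nxR KF).1 hK).
have h2 := haslen_cat h1 hx.
have [p [q [hp hq e]]] := haslen_split (@scale_sub_sub _ _ x K) KF h2.
have qk := haslen_uniq hq hK.
by have -> : n = p by lia.
Qed.

Section Duality.
Variables (R : comNzRingType) (m : ideal R) (x : R).
Hypotheses (noethR : noetherian R) (locR : local_ring m) (xm : x \in m).
Hypothesis rx : regular x.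
Hypothesis px : exists n, {subset ideal_exp m n <= (line_sub (x : R^o) : ideal R)}.

Let xR : ideal R := line_sub (x : R^o).

Lemma primary_sub (I J : ideal R) : {subset I <= J} -> primary m I -> primary m J.
Proof. by move=> IJ [n Hn]; exists n => a /Hn/IJ. Qed.

Lemma primary_line (I : ideal R) : x \in I -> primary m I.
Proof. by move=> xI; apply: primary_sub px => a; exact: line_sub_min. Qed.

Section Module.
Variable C : lmodType R.
Let xC : submodClosed C := scale_image x C.
Hypotheses (nx : nonzerodivisor C x) (liftC : liftable m x C).
Hypothesis socC : haslen xC (colon_sub m xC) 1.

Lemma haslen1_generator : exists sigma, [/\ sigma \notin xC,
  forall a : R, a \in m -> a *: sigma \in xC &
  forall v, (forall a : R, a \in m -> a *: v \in xC) ->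
    exists r : R, v - r *: sigma \in xC].
Proof.
have [|s sC sx] := @not_subP R C xC (colon_sub m xC).
  by move=> H; have := haslen_uniq socC (haslen0 (haslen_sub socC) H).
have ms := (colon_subP _ _ _).1 sC; exists s; split=> // v mv.
have sub : {subset add_sub xC (line_sub s) <= colon_sub m xC}.
  by apply: add_sub_min; [exact: haslen_sub socC|exact: line_sub_min].
have h1 := haslen_step noethR locR sx ms.
have [p [q [hp hq e]]] := haslen_split (haslen_sub h1) sub socC.
have q0 : q = 0%N by have := haslen_uniq h1 hp; lia.
rewrite q0 in hq; have := haslen0_sub hq ((colon_subP _ _ _).2 mv).
move=> /add_subP[u [_ [ux /line_subP[r ->] ->]]].
by exists r; rewrite addrK.
Qed.

(* C/xC is an injective module over R/xR. *)
Lemma extend_mod (I : ideal R) (k : R^o -> quotmod xC) :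
  lin_on I k -> x \in I -> k x = 0 ->
  exists c, forall a : R, a \in I -> k a = quotmod_pi xC (a *: c).
Proof.
move=> kI xI kx; have [h [hI hk]] := liftC (primary_line xI) kI.
have /quotmod_pi0P/scale_imageP[c cE] : quotmod_pi xC (h x) = 0 by rewrite hk.
exists c => a aI; rewrite -hk //; congr (quotmod_pi _ _); apply: (nzd_inj nx).
rewrite -(lin_onZ hI) // scalerA mulrC -scalerA -cE -(lin_onZ hI) //.
by congr h; exact: mulrC.
Qed.

(** (xC : I)/xC is the dual Hom(R/I, C/xC). For a socle element t of R/I, multiplication by t maps
    xC : I onto xC : m modulo xC, with kernel xC : (I + tR), so both lengths drop by one when t is
    adjoined. *)
Lemma haslen_colon n : forall I : ideal R, x \in I -> haslen I (full_sub _) n ->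
  haslen xC (colon_sub I xC) n.
Proof.
elim: n => [|n IH] I xI hI.
  apply: haslen0 => [v vx|v /colon_subP H].
    by apply/colon_subP => a _; exact: subZ.
  by rewrite -[v]scale1r; apply: H; exact: (haslen0_sub hI (full_subP _)).
have [k mI] := primary_line xI.
have [||t [_ tI mt]] := @simple_step R m R^o I (full_sub _) k.
- by move=> r v /mI rI _; rewrite [_ *: _]mulrC; exact: idealM.
- move=> H; have := haslen_uniq hI (haslen0 _ H).
  by move=> /(_ (fun v _ => full_subP v)).
have h1 := haslen_step noethR locR tI mt.
set I1 : ideal R := add_sub I (line_sub t) in h1.
have [p [q [hp hq e]]] := haslen_split (haslen_sub h1) (fun v _ => full_subP v) hI.
have qn : q = n by have := haslen_uniq h1 hp; lia.
rewrite {q e}qn in hq.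
have xI1 : x \in I1 by exact: add_subl.
have tI1 : t \in I1 by apply: add_subr; exact: line_sub_id.
rewrite -addn1; apply: haslen_cat (IH I1 xI1 hq) _.
have H : hommod (colon_sub I xC) xC (fun c => (t : R) *: c).
  by move=> r u v _ _; rewrite scalerDr !scalerA mulrC subrr sub0.
apply/(haslen_iso H); last exact: socC.
split.
- exact: haslen_sub socC.
- move=> v /colon_subP Hv; apply/colon_subP => a aI.
  by apply: Hv; exact: add_subl.
- move=> v /colon_subP Hv; apply/colon_subP => a am; rewrite scalerA.
  by apply: Hv; exact: mt.
- move=> v /colon_subP Hv; apply/idP/idP => [tv|/colon_subP Hv1]; last exact: Hv1.
  apply/colon_subP => _ /add_subP[a [_ [aI /line_subP[r ->] ->]]].
  rewrite scalerDl; apply: subD; first exact: Hv.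
  by rewrite -scalerA; exact: subZ.
(* Surjectivity: the map that kills I and sends t to w extends to R, hence is multiplication by some
   c. *)
move=> w /colon_subP mw.
have L0 : lin_on I (fun=> 0 : quotmod xC).
  by move=> r u v _ _; rewrite scaler0 addr0.
have [|k' [k'L k'I k't]] := @lin_on_adjoin R R^o _ I _ (t : R^o) (quotmod_pi xC w) L0.
  move=> r rt; rewrite [RHS]quotmod_scale_pi; apply/esym/quotmod_pi0P/mw.
  exact: notin_maxP tI rt.
have [c cE] := extend_mod k'L xI1 (k'I _ xI).
exists c.
  apply/colon_subP => a aI; apply/quotmod_pi0P; rewrite -cE ?k'I //.
  exact: add_subl.
rewrite -quotmod_piE; apply/eqP; rewrite -k't; exact: cE.
Qed.

Lemma haslen_scale_image n : haslen xR (full_sub _) n -> haslen xC (full_sub _) n.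
Proof.
move=> /haslen_colon-/(_ (line_sub_id _)); apply: haslen_eq => // v.
rewrite full_subP; apply/colon_subP => _ /ideal_lineP[r ->].
by rewrite -scalerA; apply: subZ; apply/scale_imageP; exists v.
Qed.

(** If r outside xR killed C/xC, so would a socle element t of (xR + rR)/xR. But the map sending t
    to a socle generator extends to R, so that generator is t c for some c. *)
Lemma faithful_mod (r : R) : (forall c : C, r *: c \in xC) -> r \in xR.
Proof.
move=> Hr; apply: contrapT => /negP rR; have [n Hn] := px.
have [s [sx ms _]] := haslen1_generator.
have [||t [tC tR mt]] := @simple_step R m R^o xR (add_sub xR (line_sub (r : R^o))) n.
- by move=> a v /Hn ax _; rewrite [_ *: _]mulrC; exact: idealM.
- by move=> H; case/negP: rR; apply/H/add_subr/line_sub_id.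
have L0 : lin_on xR (fun=> 0 : quotmod xC).
  by move=> a u v _ _; rewrite scaler0 addr0.
have [|k' [k'L k'I k't]] := @lin_on_adjoin R R^o _ xR _ (t : R^o) (quotmod_pi xC s) L0.
  move=> a at_; rewrite [RHS]quotmod_scale_pi; apply/esym/quotmod_pi0P/ms.
  exact: notin_maxP tR at_.
have [|c cE] := extend_mod k'L _ (k'I _ (line_sub_id _)).
  by apply: add_subl; exact: line_sub_id.
case/negP: sx; apply/quotmod_pi0P; rewrite -k't cE; last first.
  by apply: add_subr; exact: line_sub_id.
apply/quotmod_pi0P; move/add_subP: tC => [_ [_ [/line_subP[b ->] /line_subP[b' ->] ->]]].
rewrite scalerDl -!scalerA; apply: subD; apply: subZ; last exact: Hr.
by apply/scale_imageP; exists c.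
Qed.

(** Adjoining a socle element t of M'/M to M shrinks the annihilator by at most one step: the map
    sending r to r t embeds the quotient of the two annihilators into the simple socle of C/xC. *)
Lemma ann_chain_bound (M' : submodClosed C) p : forall M : submodClosed C, {subset xC <= M} ->
  haslen M M' p -> ~ chain (ann_sub M' xC) (ann_sub M xC) p.+1.
Proof.
elim: p => [|p IH] M xM hM.
  move=> [I annI [IM nMI]]; apply: nMI => r /ann_subP rM; apply: annI.
  by apply/ann_subP => v /(haslen0_sub hM); exact: rM.
have [n Hn] := px.
have [||t [tM' tM mt]] := @simple_step R m C M M' n.
- move=> _ v /Hn/ideal_lineP[b ->] _; apply: xM; rewrite -scalerA.
  by apply: subZ; apply/scale_imageP; exists v.
- by move=> H; have := haslen_uniq hM (haslen0 (haslen_sub hM) H).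
have h1 := haslen_step noethR locR tM mt.
set M1 := add_sub M (line_sub t) in h1.
have M1M' : {subset M1 <= M'}.
  by apply: add_sub_min; [exact: haslen_sub hM|exact: line_sub_min].
have [i [j [hi hj e]]] := haslen_split (haslen_sub h1) M1M' hM.
have jp : j = p by have := haslen_uniq h1 hi; lia.
rewrite {j e}jp in hj; have MM1 := haslen_sub h1.
rewrite -[p.+1]addn1; apply: (@chain_bound_cat R R^o _ (ann_sub M1 xC)).
- by move=> r /ann_subP rM'; apply/ann_subP => v /M1M'; exact: rM'.
- by move=> r /ann_subP rM1; apply/ann_subP => v /MM1; exact: rM1.
- exact: (IH M1 (fun v vx => MM1 v (xM v vx)) hj).
move=> c2; have H : hommod (ann_sub M xC) xC (fun r : R^o => (r : R) *: t).
  by move=> r u v _ _; rewrite scalerDl scalerA subrr sub0.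
suff /(haslen_leq socC) : chain xC (colon_sub m xC) 2 by [].
apply: (@chain_push R R^o C (ann_sub M1 xC) (ann_sub M xC) _ _ _ H 2 _ _ _ c2).
- exact: haslen_sub socC.
- move=> r /ann_subP rM; apply/colon_subP => a am.
  by rewrite scalerA mulrC -scalerA; apply: rM; exact: mt.
- move=> r /ann_subP rM rt; apply/ann_subP => _ /add_subP[u [_ [uM /line_subP[b ->] ->]]].
  rewrite scalerDr; apply: subD; first exact: rM.
  by rewrite scalerA mulrC -scalerA; exact: subZ.
Qed.

(* The bounds of [ann_chain_bound] for M and for xC in M are both sharp, because
   they add up to the common length of R/xR and C/xC. *)
Lemma haslen_ann (M : submodClosed C) mu : {subset xC <= M} ->
  haslen M (full_sub _) mu -> haslen xR (ann_sub M xC) mu.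
Proof.
move=> xM hM; have [k Hk] := px; have [n hn] := haslen_quotient noethR locR Hk.
have [p [q [hp hq e]]] :=
  haslen_split xM (fun v _ => full_subP v) (haslen_scale_image hn).
have {q hq e} [hq e] : haslen M (full_sub _) mu /\ n = (p + mu)%N.
  by rewrite -(haslen_uniq hq hM).
have annx : {subset xR <= ann_sub M xC}.
  move=> _ /ideal_lineP[r ->]; apply/ann_subP => v _; rewrite -scalerA; apply: subZ.
  by apply/scale_imageP; exists v.
have [q1 [q2 [h1 h2 e']]] := haslen_split annx (fun v _ => full_subP v) hn.
have l1 : (q1 <= mu)%N.
  rewrite leqNgt; apply/negP => lt; apply: (ann_chain_bound xM hM).
  apply: chain_leq lt _; apply: (@chain_cat _ _ _ xR _ 0) h1.1 => r /ann_subP H.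
  by apply: faithful_mod => c; apply: H; exact: full_subP.
have l2 : (q2 <= p)%N.
  rewrite leqNgt; apply/negP => lt; apply: (ann_chain_bound _ hp) => //.
  apply: chain_leq lt _; apply: chain_widen h2.1 => r _; apply/ann_subP => v.
  exact: subZ.
by have <- : q1 = mu by lia.
Qed.

(** [s0] generates the simple socle of K/xK. Sending it to a socle generator of C/xC extends to g on
    K; its kernel is xK because it does not kill the socle, and it is onto because K/xK and C/xC
    both have the length of R/xR. Nakayama makes a lift of g to C bijective. *)
Lemma canonical_unique (K : ideal R) (s0 : R) : finitely_generated C ->
  primary m K -> s0 \in K -> s0 \notin scale_sub x K ->
  (forall a : R, a \in m -> a * s0 \in scale_sub x K) ->
  (forall v : R, v \in K -> (forall a : R, a \in m -> a * v \in scale_sub x K) ->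
    exists r, v - r * s0 \in scale_sub x K) ->
  exists h : R^o -> C, [/\ lin_on K h, forall a : R, a \in K -> h a = 0 -> a = 0 &
    forall c, exists2 a : R, a \in K & h a = c].
Proof.
move=> fgC pK s0K s0x ms0 s0gen; have [s [sx ms _]] := haslen1_generator.
have pi_linear := quotmod_pi_linear xC.
set xK : ideal R := scale_sub x K in s0x ms0 s0gen.
have xKK : {subset xK <= K} by exact: scale_sub_sub.
have L0 : lin_on xK (fun=> 0 : quotmod xC).
  by move=> a u v _ _; rewrite scaler0 addr0.
have [|k [kL kx ks]] := @lin_on_adjoin R R^o _ xK _ (s0 : R^o) (quotmod_pi xC s) L0.
  move=> a as0; rewrite [RHS]quotmod_scale_pi; apply/esym/quotmod_pi0P/ms.
  exact: notin_maxP s0x as0.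
have [|||g [gK _ gk]] := @baer R noethR _ (full_sub _) _ K k kL.
- by move=> a _; exact: full_subP.
- by apply: add_sub_min => //; exact: line_sub_min.
(* Adjoining t means extending the map sending r to g(r t) from the ideal S : t, which contains x,
   to all of R. *)
- move=> S g gS _ IS gk SK nKS; have [t tK tS] := not_subP nKS.
  have [|||c cE] := @extend_mod (ann_sub (line_sub t) S) (fun r : R^o => g ((r : R) *: t)).
  + move=> r a b /ann_subP/(_ _ (line_sub_id _)) aS /ann_subP/(_ _ (line_sub_id _)) bS.
    by rewrite -gS // scalerDl scalerA.
  + apply/ann_subP => _ /line_subP[r ->]; rewrite scalerA mulrC -scalerA.
    apply: subZ; apply: IS; apply: add_subl; apply/scale_idealP.
    by exists t.
  + have xt : x *: t \in xK by apply/scale_idealP; exists t.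
    by rewrite gk ?kx //; exact: add_subl.
  exists t, (quotmod_pi xC c); split=> // [|r rt]; first exact: full_subP.
  rewrite cE; last by apply/ann_subP => _ /line_subP[a ->]; rewrite scalerA mulrC -scalerA; exact: subZ.
  by rewrite [RHS]quotmod_scale_pi.
have gx a : a \in xK -> g a = 0.
  by move=> ax; rewrite gk ?kx //; exact: add_subl.
have gs : g s0 = quotmod_pi xC s.
  by rewrite gk //; apply: add_subr; exact: line_sub_id.
have g_inj v : v \in K -> g v = 0 -> v \in xK.
  move=> vK gv; apply: contrapT => /negP vx; have [n Hn] := px.
  have [||t [tC tx mt]] := @simple_step R m R^o xK (add_sub xK (line_sub (v : R^o))) n.
  - move=> a w /Hn/ideal_lineP[b ->] wC; rewrite [_ *: _](_ : _ = x * (b * w)).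
      apply/scale_idealP; exists (b * w) => //; apply: idealM.
      by move: w wC; apply: add_sub_min => //; exact: line_sub_min.
    by rewrite [b * x]mulrC [RHS]mulrA.
  - by move=> H; case/negP: vx; apply/H/add_subr/line_sub_id.
  have gt : g t = 0.
    move/add_subP: tC => [b [_ [bx /line_subP[r ->] ->]]].
    rewrite addrC gK //; last exact: xKK.
    by rewrite gv gx // scaler0 addr0.
  have tK : t \in K.
    by move: t tC {tx mt gt}; apply: add_sub_min => //; exact: line_sub_min.
  have [r rE] := s0gen t tK mt.
  have : r \in m.
    have : g (r *: (s0 : R^o)) = 0.
      have -> : r *: (s0 : R^o) = t - (t - r * s0) by rewrite opprB addrC subrK.
      by rewrite (lin_onB gK) // ?gt ?gx ?subrr //; exact: xKK.
    rewrite (lin_onZ gK) // gs [_ *: _]quotmod_scale_pi => /quotmod_pi0P rs.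
    apply: contrapT => /negP rm; case/negP: sx.
    exact: (sub_unitZ noethR locR rm).
  move=> /ms0 rs0; case/negP: tx.
  by have -> : t = (t - r * s0) + r * s0 by [rewrite subrK]; exact: idealD.
have [n hn] : exists n, haslen xR (full_sub _) n.
  by have [k' Hk] := px; exact: haslen_quotient noethR locR _ _ Hk.
have [k' hK] : exists n, haslen K (full_sub _) n.
  by have [k' Hk] := pK; exact: haslen_quotient noethR locR _ _ Hk.
have g_surj w : exists2 a : R, a \in K & g a = w.
  have H : hommod K (zero_sub _) g.
    by move=> r u v uK vK; rewrite gK // subrr sub0.
  have c1 : chain (zero_sub _) (hommod_image H) n.
    apply: (@chain_push R R^o _ (scale_sub x K) K _ _ g H n _ _ _ (haslen_scale_ideal rx hK hn).1).
    - by move=> _ /zero_subP ->; exact: sub0.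
    - by move=> v vK; apply/hommod_imageP; exists v; rewrite ?subrr ?sub0.
    - by move=> v vK /zero_subP/(g_inj v vK).
  have hC := (haslen_quotmod xC n).1 (haslen_scale_image hn).
  have /(_ w (full_subP _)) : {subset full_sub _ <= hommod_image H}.
    apply: contrapT => nsub; apply: hC.2; exists (hommod_image H) => //.
    by split=> // v _; exact: full_subP.
  move=> /hommod_imageP[a aK /zero_subP/eqP]; rewrite subr_eq0 => /eqP ->.
  by exists a.
have [h [hK' hE]] := liftC pK gK; exists h; split=> //.
- pose kerP (a : R^o) := a \in K /\ h a = 0.
  have kerS : submodule_prop kerP.
    split; first by rewrite /kerP sub0 (lin_on0 hK').
    move=> r u v [uK hu] [vK hv]; split; first by apply: subD => //; exact: subZ.
    by rewrite hK' // hu hv scaler0 addr0.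
  move=> a aK ha; apply/(zero_subP (a : R^o)).
  (* A kernel element is x u with u in K, and x h(u) = 0 puts u in the kernel too: the kernel lies
     in m times itself. *)
  apply: (nakayama_ideal noethR locR (I := mksub kerS)); last exact/mksubP.
  move=> b /mksubP[bK hb]; apply: add_subr.
  have /scale_idealP[u uK bE] : b \in xK by apply: g_inj => //; rewrite -hE // hb; exact/quotmod_pi0P/sub0.
  rewrite bE; apply: in_ideal_mul => //; apply/mksubP; split=> //.
  by apply: nx; rewrite -(lin_onZ hK') // [_ *: _](esym bE).
pose imP (c : C) := exists2 a : R^o, a \in K & h a = c.
have imS : submodule_prop imP.
  split; first by exists 0; [exact: sub0|exact: lin_on0 hK'].
  move=> r _ _ [u uK <-] [v vK <-]; exists (r *: u + v); last by rewrite hK'.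
  by apply: subD => //; exact: subZ.
move=> c; have /mksubP[a aK <-] : c \in mksub imS; last by exists a.
apply: (nakayama_mod noethR locR xm fgC) => v.
have [a aK ga] := g_surj (quotmod_pi xC v).
exists (h a); first by apply/mksubP; exists a.
have /scale_imageP[w wE] : v - h a \in xC.
  by rewrite -quotmod_piE -ga hE.
by exists w; rewrite -wE addrC subrK.
Qed.

End Module.
End Duality.

(** * Principal reductions *)

(** Otherwise the successive spans over [A] would increase strictly l + 1 times. Expressing u k by
    earlier terms is what later makes a polynomial monic. *)
Lemma chain_relation (R : comNzRingType) (V : lmodType R) (A B : submodClosed V)
  l (u : nat -> V) : haslen A B l -> (forall i, (i <= l)%N -> u i \in B) ->
  exists k (c : nat -> R), (k <= l)%N /\
    u k - \sum_(i < k) c i *: u i \in A.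
Proof.
move=> hAB uB; apply: contrapT => nrel; have AB := haslen_sub hAB.
pose spanP k v := exists c : nat -> R, v - \sum_(i < k) c i *: u i \in A.
have spanS k : submodule_prop (spanP k).
  split; first by exists (fun=> 0); rewrite big1 ?subrr ?sub0 // => i _; rewrite scale0r.
  move=> r v w [c cv] [d dw]; exists (fun i => r * c i + d i).
  rewrite (eq_bigr (fun i : 'I_k => r *: (c i *: u i) + d i *: u i)); last first.
    by move=> i _; rewrite scalerDl scalerA.
  rewrite big_split -scaler_sumr opprD addrACA -scalerBr.
  by apply: subD => //; exact: subZ.
suff H k : (k <= l.+1)%N -> chain A (mksub (spanS k)) k.
  apply: hAB.2; apply: chain_widen (H _ (leqnn _)) => v /mksubP[c /AB vB].
  apply: sub_congr vB _; apply: sub_sum => i _; apply: subZ; apply: uB.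
  by rewrite -ltnS.
elim: k => [|k IH] kl /=.
  move=> v vA; apply/mksubP; exists (fun=> 0).
  by rewrite big_ord0 subr0.
exists (mksub (spanS k)); first by apply: IH; exact: ltnW.
split=> [v /mksubP[c cv]|H].
  apply/mksubP; exists (fun i => if (i < k)%N then c i else 0).
  rewrite big_ord_recr /= ltnn scale0r addr0.
  by rewrite (eq_bigr (fun i : 'I_k => c i *: u i)) // => i _; rewrite ltn_ord.
have /H/mksubP[c uE] : u k \in mksub (spanS k.+1).
  apply/mksubP; exists (fun i => (i == k)%:R).
  rewrite big_ord_recr /= eqxx scale1r big1 ?add0r ?subrr ?sub0 // => i _.
  by rewrite (ltn_eqF (ltn_ord i)) scale0r.
by apply: nrel; exists k, c.
Qed.

Section PrincipalReduction.
Variables (R : comNzRingType) (m : ideal R) (x : R).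
Hypotheses (noethR : noetherian R) (locR : local_ring m) (xm : x \in m).
Hypothesis rx : regular x.
Hypothesis px : exists n, {subset ideal_exp m n <= (line_sub (x : R^o) : ideal R)}.
Hypothesis infk : infinite_set [set: quotmod m].

(** m^n/m^(n+1) is a quotient of m^n/x m^n, which has the length of R/xR for every n. *)
Lemma haslen_exp_bound : exists e, forall n, exists2 l, (l <= e)%N &
  haslen (ideal_exp m n.+1) (ideal_exp m n) l.
Proof.
have [k Hk] := px; have [e he] := haslen_quotient noethR locR Hk.
exists e => n; have [l hl] := haslen_quotient noethR locR (fun v (H : v \in ideal_exp m n) => H).
have h := haslen_scale_ideal rx hl he.
have [||p [q [hp hq ->]]] := haslen_split (B := ideal_exp m n.+1) _ _ h.
- by move=> _ /scale_idealP[u um ->]; exact: in_ideal_mul.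
- exact: ideal_expS_sub.
by exists q => //; exact: leq_addl.
Qed.

Lemma distinct_residues n : exists s : seq R, size s = n /\
  pairwise (fun a b => a - b \notin m) s.
Proof.
have [B _ Bn] := infinite_set_fset n infk.
exists (take n [seq (repr w : R^o) | w <- (B : seq (quotmod m))]); split.
  by rewrite size_takel // size_map.
rewrite -map_take pairwise_map.
have := take_uniq n (fset_uniq B); rewrite uniq_pairwise; apply: sub_pairwise => a b /=.
move=> ab; apply: contra ab => H.
by rewrite -[a]quotmod_piK -[b]quotmod_piK quotmod_piE.
Qed.

(** The root count over the residue field, carried out in R: the degree is size s - 1, and since b -
    a is a unit, splitting off X - a passes a root b modulo m on to the quotient. *)
Lemma poly_nonroot (s : seq R) : pairwise (fun a b => a - b \notin m) s ->
  forall p : {poly R}, size p = size s -> (0 < size s)%N -> lead_coef p \notin m ->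
  exists2 a, a \in s & p.[a] \notin m.
Proof.
elim: s => [|a s IH] //= /andP[/allP as_ ps] p psz _ lp.
case: (ltnP 0 (size s)) => [s0|]; last first.
  rewrite leqn0 => /eqP s0; exists a; first exact: mem_head.
  have /size_poly1P : size p == 1%N by rewrite psz s0.
  case=> c c0 pE; move: lp; rewrite pE lead_coefC hornerC //.
case: (boolP (p.[a] \in m)) => [pa|]; last by exists a => //; exact: mem_head.
have /factor_theorem[q qE] : root (p - p.[a]%:P) a.
  by rewrite rootE hornerD hornerN hornerC subrr.
have pE : p = q * ('X - a%:P) + p.[a]%:P by rewrite -qE subrK.
have q0 : q != 0.
  apply/eqP => q0; move: psz s0; rewrite pE q0 mul0r add0r.
  move=> psz; have := size_polyC_leq1 p.[a]; rewrite psz ltnS leqn0.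
  by move=> /eqP ->.
have szq : size (q * ('X - a%:P)) = (size q).+1.
  by rewrite size_Mmonic ?monicXsubC // size_XsubC addn2.
have small : (size (p.[a]%:P)%R < size (q * ('X - a%:P))%R)%N.
  by rewrite szq ltnS (leq_trans (size_polyC_leq1 _)) // size_poly_gt0.
have [||b bs qb] := IH ps q _ s0.
- by have := psz; rewrite pE size_polyDl // szq => -[].
- by move: lp; rewrite pE lead_coefDl // lead_coef_Mmonic // monicXsubC.
exists b; first by rewrite inE bs orbT.
apply/negP => pb; have : q.[b] * (b - a) \in m.
  have -> : q.[b] * (b - a) = p.[b] - p.[a].
    by rewrite {1}pE hornerD hornerM hornerXsubC hornerC addrK.
  exact: (@subB R R^o).
move=> /(max_prime noethR locR)[H|H]; first by rewrite H in qb.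
by have /negP := as_ b bs; apply; rewrite -opprB; exact: (@subN R R^o).
Qed.

Lemma power_combination (a b r w : R) i j : a \in m -> b \in m -> a = w + r * b ->
  a ^+ i * b ^+ j - r ^+ i * b ^+ (i + j) \in
    (scale_sub w (ideal_exp m (i + j).-1) : ideal R).
Proof.
move=> am bm aE; elim: i => [|i IH]; first by rewrite !mul1r subrr; exact: sub0.
have /scale_idealP[u um uE] := IH.
apply/scale_idealP; exists (a ^+ i * b ^+ j + r * (b * u)).
  rewrite addSn /=; apply: idealD; first by apply: ideal_exp_mulD; exact: expr_ideal_exp.
  apply: idealM; have : b * u \in ideal_exp m (i + j).-1.+1 by exact: in_ideal_mul.
  by apply: ideal_exp_leq; lia.
have -> : w * (a ^+ i * b ^+ j + r * (b * u)) =
    w * (a ^+ i * b ^+ j) + r * b * (w * u).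
  by rewrite mulrDr [w * (r * _)]mulrCA [w * (b * u)]mulrCA [r * (b * _)]mulrA.
rewrite -uE addSn !exprS.
have -> : w = a - r * b by rewrite aE addrK.
by rewrite mulrBl mulrBr addrA subrK [a * (_ * _)]mulrA [r * b * _]mulrACA.
Qed.

(** A relation among the monomials of degree d in a and b yields a monic p. Where p(r) is a unit, w
    = a - r b satisfies b^d in J' m^(d-1) + m^(d+1) for J' = wR + L, so b can be dispensed with. *)
Lemma reduction_step (a b : R) (L : ideal R) : a \in m -> b \in m ->
  {subset L <= m} ->
  reduction (add_sub (line_sub (a : R^o)) (add_sub (line_sub (b : R^o)) L)) m ->
  exists r, reduction (add_sub (line_sub (a - r * b : R^o)) L) m.
Proof.
move=> am bm Lm redJ.
have [e He] := haslen_exp_bound.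
(* As l <= e < d, degree d has the l + 1 monomials needed, one more than the length of
   m^d/m^(d+1). *)
pose d := e.+1; have [l le hl] := He d.
have [|k [c [kl rel]]] := @chain_relation R R^o _ _ l
    (fun i => a ^+ i * b ^+ (d - i)) hl.
  move=> i il; have -> : ideal_exp m d = ideal_exp m (i + (d - i)).
    by congr ideal_exp; rewrite /d; lia.
  by apply: ideal_exp_mulD; exact: expr_ideal_exp.
pose p : {poly R} := 'X^k - \poly_(i < k) c i.
have szp : size p = k.+1.
  by rewrite size_polyDl size_polyXn // size_polyN ltnS size_poly.
have lp : lead_coef p \notin m.
  rewrite lead_coefDl ?lead_coefXn ?(max_notin1 locR) //.
  by rewrite size_polyN size_polyXn ltnS size_poly.
have [s [ss ps]] := distinct_residues k.+1.
have [|r rs pr] := poly_nonroot ps (etrans szp (esym ss)) _ lp; first by rewrite ss.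
exists r; set w := a - r * b.
have aE : a = w + r * b by rewrite subrK.
have wm : w \in m by apply: (@subB R R^o) => //; exact: idealM.
set J' : ideal R := add_sub _ L.
have wJ : w \in J' by apply: add_subl; exact: line_sub_id.
have J'm : {subset J' <= m} by apply: add_sub_min => //; exact: line_sub_min.
(* Substituting a = w + r b into the relation leaves p(r) b^d. *)
pose T : ideal R := add_sub (ideal_mul J' (ideal_exp m d.-1) : ideal R)
    (ideal_exp m d.+1).
have bd : b ^+ d \in T.
  have pc i : (i <= l)%N -> a ^+ i * b ^+ (d - i) - r ^+ i * b ^+ d \in
      ideal_mul J' (ideal_exp m d.-1).
    move=> il; have := power_combination i (d - i) am bm aE.
    have -> : (i + (d - i) = d)%N by rewrite /d; lia.
    by move=> /scale_idealP[u um ->]; exact: in_ideal_mul.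
  apply: (sub_unitZ noethR locR (V := R^o) pr); rewrite [_ *: _]/(_ * _).
  suff : p.[r] * b ^+ d \in T by [].
  have -> : p.[r] * b ^+ d =
     (r ^+ k * b ^+ d - a ^+ k * b ^+ (d - k)) +
     (\sum_(i < k) c i * (a ^+ i * b ^+ (d - i) - r ^+ i * b ^+ d)) +
     (a ^+ k * b ^+ (d - k) - \sum_(i < k) c i * (a ^+ i * b ^+ (d - i))).
    rewrite hornerD hornerN hornerXn horner_poly mulrBl mulr_suml.
    under [X in _ = _ + X + _]eq_bigr do rewrite mulrBr.
    rewrite sumrB; under eq_bigr do rewrite -mulrA.
    by rewrite [RHS]addrAC !subrKA.
  apply: idealD; last exact: add_subr rel.
  apply: add_subl; apply: idealD.
    by rewrite -opprB; apply: (@subN R R^o); exact: pc.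
  apply: (@sub_sum R R^o) => i _; apply: idealM; apply: pc.
  by have := ltn_ord i; lia.
have [n0 Hn0] := reductionS_ge redJ.
have expE (r1 r2 u v : R) : (r1 * a + (r2 * b + u)) * v =
    (r1 * w + u) * v + b * ((r1 * r + r2) * v).
  rewrite [b * _]mulrA -mulrDl {1}aE; congr (_ * v).
  rewrite mulrDr [b * _]mulrC mulrDl -mulrA.
  by rewrite [r2 * b + u]addrC addrACA.
(* Each use of the given reduction, with a written as w + r b, leaves a part with a factor in J' and
   a part with one more factor b. *)
have expand k' : {subset ideal_exp m (n0 + k') <= (add_sub
    (ideal_mul J' (ideal_exp m (n0 + k').-1) : ideal R)
    (scale_sub (b ^+ k') (ideal_exp m n0)) : ideal R)}.
  elim: k' => [|k' IH] y.
    rewrite addn0 => yn; apply: add_subr; apply/scale_idealP; exists y => //.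
    by rewrite mul1r.
  rewrite addnS Hn0 ?leq_addr //; move: y; apply: ideal_mul_min => u v.
  move=> /add_subP[_ [t [/line_subP[r1 ->] /add_subP[_ [u' [/line_subP[r2 ->] uL ->]]] ->]]] vn.
  rewrite [X in X \in _]expE.
  apply: idealD.
    apply: add_subl; apply: in_ideal_mul => //; apply: idealD; first exact: idealM.
    exact: add_subr.
  have /IH/add_subP[y [_ [yJ /scale_idealP[z zn ->] ->]]] :
      (r1 * r + r2) * v \in ideal_exp m (n0 + k') by exact: idealM.
  rewrite mulrDr; apply: idealD; last first.
    apply: add_subr; apply/scale_idealP; exists z => //.
    by rewrite exprS mulrA.
  apply: add_subl; move: y yJ.
  suff H : {subset ideal_mul J' (ideal_exp m (n0 + k').-1) <=
     (colon_sub (line_sub (b : R^o)) (ideal_mul J' (ideal_exp m (n0 + k'))) : ideal R)}.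
    by move=> y /H/colon_subP/(_ b (line_sub_id _)).
  apply: ideal_mul_min => f g fJ gm; apply/colon_subP => _ /ideal_lineP[q ->].
  rewrite [_ *: _](_ : _ = f * (q * (b * g))); last by rewrite [LHS]mulrCA -mulrA.
  apply: in_ideal_mul => //; apply: idealM.
  have : b * g \in ideal_exp m (n0 + k').-1.+1 by exact: in_ideal_mul.
  by apply: ideal_exp_leq; exact: leqSpred.
have Jsub n : {subset ideal_mul J' (ideal_exp m n) <= ideal_exp m n.+1}.
  exact: ideal_mulS.
(* After d steps b^d is traded for an element of J' m^(d-1) + m^(d+1); the error lies in m^(n0+d+1)
   and is absorbed by Nakayama. *)
split=> //; exists (n0 + d).-1 => y; apply/idP/idP; last exact: Jsub.
have -> : (n0 + d).-1.+1 = (n0 + d)%N by rewrite /d addnS.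
move: y; apply: (nakayama_ideal noethR locR) => y /expand/add_subP[u [_ [uJ /scale_idealP[v vn ->] ->]]].
apply: idealD; first exact: add_subl.
move/add_subP: bd => [f [g [fJ gm ->]]]; rewrite mulrDl; apply: idealD.
  apply: add_subl; move: f fJ.
  suff H : {subset ideal_mul J' (ideal_exp m d.-1) <=
     (colon_sub (line_sub (v : R^o)) (ideal_mul J' (ideal_exp m (n0 + d).-1)) : ideal R)}.
    by move=> f /H/colon_subP/(_ v (line_sub_id _)); rewrite [_ *: _]mulrC.
  apply: ideal_mul_min => f h fJ hm; apply/colon_subP => _ /ideal_lineP[q ->].
  rewrite [_ *: _](_ : _ = f * (q * (v * h))); last by rewrite [LHS]mulrCA -mulrA.
  apply: in_ideal_mul => //; apply: idealM.
  have := ideal_exp_mulD vn hm.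
  by have -> : (n0 + d.-1 = (n0 + d).-1)%N by rewrite /d addnS.
apply: add_subr; have : g * v \in ideal_exp m (d.+1 + n0) by exact: (ideal_exp_mulD gm vn).
by rewrite addSn addnC.
Qed.

Lemma reduction_ext (I J : ideal R) : I =i J -> reduction I m -> reduction J m.
Proof.
move=> IJ [Im [n Hn]]; split=> [y|]; first by rewrite -IJ; exact: Im.
exists n => y; rewrite Hn; apply/idP/idP; apply: ideal_mulS => // z; by rewrite IJ.
Qed.

Lemma principal_reduction (K : ideal R) : reduction K m ->
  exists2 w : R, w \in K & reduction (line_sub (w : R^o)) m.
Proof.
move=> redK; have [s [sK Kmin]] := fg_ideal_ind noethR K.
pose spn (s : seq R) : ideal R :=
  foldr (fun a I => add_sub (line_sub (a : R^o)) I) (zero_sub R^o) s.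
have spn_sub s' : (forall a, a \in s' -> a \in K) -> {subset spn s' <= K}.
  elim: s' => [|a s' IH] H /=; first by move=> y /zero_subP ->; exact: sub0.
  apply: add_sub_min; first by apply: line_sub_min; apply: H; exact: mem_head.
  by apply: IH => b bs; apply: H; rewrite inE bs orbT.
have spn_mem s' a : a \in s' -> a \in spn s'.
  elim: s' => [|b s' IH] //=; rewrite inE => /predU1P[->|/IH H].
    by apply: add_subl; exact: line_sub_id.
  exact: add_subr.
have : reduction (spn s) m.
  apply: reduction_ext redK => y; apply/idP/idP; last exact: spn_sub.
  by apply: Kmin => a; exact: spn_mem.
have Km := redK.1.
(* Induction on the number of generators: each reduction step merges the first two. *)
have [n ns] := ubnP (size s); elim: n => // n IH in s sK ns {Kmin} *.
case: s sK ns => [|a [|b s]] sK ns.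
- move=> red0; exists 0; first exact: sub0.
  apply: reduction_ext red0 => y; apply/idP/idP => [/zero_subP ->|]; first exact: sub0.
  by move=> /ideal_lineP[r ->]; rewrite mulr0; exact: sub0.
- move=> reda; exists a; first by apply: sK; exact: mem_head.
  apply: reduction_ext reda => y; apply/idP/idP; last exact: add_subl.
  by apply: add_sub_min => // z /zero_subP ->; exact: sub0.
have aK : a \in K by apply: sK; exact: mem_head.
have bK : b \in K by apply: sK; rewrite !inE eqxx orbT.
have sK' c : c \in s -> c \in K by move=> cs; apply: sK; rewrite !inE cs !orbT.
move=> /reduction_step[||y /(spn_sub _ sK')/Km //|r red].
- exact: Km.
- exact: Km.
apply: (IH ((a - r * b) :: s)) red => // c; rewrite inE => /predU1P[->|]; last exact: sK'.
by apply: (@subB R R^o) => //; exact: idealM.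
Qed.

End PrincipalReduction.

(** * Canonical ideals and multiplicity *)

Definition iso_on (R : comNzRingType) (K : ideal R) (C : lmodType R)
    (h : R^o -> C) :=
  [/\ lin_on K h, forall a : R, a \in K -> h a = 0 -> a = 0 &
    forall c, exists2 a : R, a \in K & h a = c].

Lemma iso_on_inj (R : comNzRingType) (K : ideal R) (C : lmodType R)
    (h : R^o -> C) (a b : R) : iso_on K h -> a \in K -> b \in K ->
  h a = h b -> a = b.
Proof.
move=> [hK inj _] aK bK e; apply/eqP; rewrite -subr_eq0; apply/eqP.
apply: inj; first exact: (@subB R R^o).
by have -> : h (a - b) = h a - h b := lin_onB hK aK bK; rewrite e subrr.
Qed.

Lemma lmod_iso_on (R : comNzRingType) (K : ideal R) (C : lmodType R) :
  lmod_iso (submod K) C -> exists h : R^o -> C, iso_on K h.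
Proof.
move=> [f [g fK gK]].
have [||a|h [hK hE]] := @linear_on_graph R R^o C K
    (fun a c => exists aK : a \in K, c = f (Sub a aK)).
- by move=> a aK; exists (f (Sub a aK)), aK.
- move=> a _ _ [aK ->] [aK' ->]; congr (f _); exact: val_inj.
- move=> b c _ _ [bK ->] [cK ->].
  have abK : a *: b + c \in K by apply: subD => //; exact: subZ.
  exists abK; rewrite -linearP; congr (f _); exact: val_inj.
exists h; split=> // [a aK ha|c].
  have [aK' haE] := hE a aK; have : f (Sub a aK') = f 0 by rewrite -haE ha linear0.
  by move=> /(can_inj fK)/(congr1 val).
exists (val (g c)); first exact: (valP (g c)).
have [gK' ->] := hE _ (valP (g c)).
by rewrite -[RHS]gK; congr (f _); exact: val_inj.
Qed.

Lemma depth1_regular (R : comNzRingType) (m : ideal R) (V : lmodType R) :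
  depth m V = 1%:E -> exists2 x : R, x \in m & nonzerodivisor V x.
Proof.
move=> dV; apply: contrapT => nx.
have : (depth m V <= 0%:E)%E.
  apply: ge_ereal_sup => _ [[|x s] [sm rs] <-] //=.
  case: nx; exists x; first by apply: sm; exact: mem_head.
  by move=> v xv; apply: (rs.1 v 0); rewrite xv scaler0.
by rewrite dV lee_fin -[X in X <= _]/(1%:R) -[X in _ <= X]/(0%:R) ler_nat.
Qed.

Lemma dimn1 (R : comNzRingType) : krull_dim R = 1%:E -> dimn R = 1%N.
Proof.
by move=> dimR; rewrite /dimn dimR /= -[X in Num.truncn X]/(1%:R) natrK.
Qed.

Section CanonicalModule.
Variables (R : comNzRingType) (m : ideal R) (x : R).
Hypotheses (noethR : noetherian R) (locR : local_ring m).
Hypothesis dimR : krull_dim R = 1%:E.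
Hypotheses (xm : x \in m) (rx : regular x).

Let px := regular_primary noethR locR dimR rx xm.

Lemma canonical_liftable (C : lmodType R) : canonical_module m C ->
  nonzerodivisor C x -> liftable m x C.
Proof.
move=> [_ _ _ fid] nx.
exact (finite_injective_dimension_liftable noethR locR xm rx px nx fid).
Qed.

Lemma canonical_socle (C : lmodType R) : canonical_module m C ->
  nonzerodivisor C x ->
  haslen (scale_image x C : submodClosed C) (colon_sub m (scale_image x C)) 1.
Proof.
move=> [_ _ E _] nx; rewrite (dimn1 dimR) in E.
exact (length_Ext1_residue1 xm E nx).
Qed.

Lemma iso_on_nonzerodivisor (K : ideal R) (C : lmodType R) (h : R^o -> C) :
  iso_on K h -> nonzerodivisor C x.
Proof.
move=> iso c; case: (iso) => hK inj surj; have [a aK <-] := surj c.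
rewrite -(lin_onZ hK) // => /inj H.
have /rx -> : x * a = 0 by apply: H; exact: idealM.
exact: lin_on0 hK.
Qed.

(** Through h0 the ideal K inherits from C0 a simple socle modulo x, which is all that the
    comparison with C asks of K. *)
Lemma canonical_ideal_iso (K : ideal R) (C0 C : lmodType R) (h0 : R^o -> C0) :
  primary m K -> canonical_module m C0 -> iso_on K h0 ->
  canonical_module m C -> nonzerodivisor C x ->
  exists h : R^o -> C, iso_on K h.
Proof.
move=> pK can0 iso0 canC nx; have nx0 := iso_on_nonzerodivisor iso0.
have [s [sx ms sgen]] := haslen1_generator noethR locR xm (canonical_socle can0 nx0).
case: (iso0) => hK inj surj; have [s0 s0K s0E] := surj s.
have xKP a : a \in K -> h0 a \in scale_image x C0 -> a \in scale_sub x K.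
  move=> aK /scale_imageP[c]; have [u uK <-] := surj c.
  rewrite -(lin_onZ hK) // => E; apply/scale_idealP; exists u => //.
  apply: iso_on_inj iso0 aK _ E; exact: idealM.
have xKP' a : a \in scale_sub x K -> h0 a \in scale_image x C0.
  move=> /scale_idealP[u uK ->]; apply/scale_imageP; exists (h0 u).
  by rewrite -(lin_onZ hK).
have fgC : finitely_generated C by case: canC.
apply: (canonical_unique noethR locR xm rx px nx (canonical_liftable canC nx)
  (canonical_socle canC nx) fgC pK s0K).
- by apply/negP => /xKP'; rewrite s0E; exact/negP.
- move=> a am; apply: xKP; first exact: idealM.
  have -> : h0 (a * s0) = a *: h0 s0 := lin_onZ hK a s0K.
  by rewrite s0E; exact: ms.
move=> v vK mv; have [|r rE] := sgen (h0 v).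
  by move=> a am; rewrite -(lin_onZ hK) //; apply: xKP'; exact: mv.
exists r; apply: xKP; first by apply: (@subB R R^o) => //; exact: idealM.
have rs0K : r * s0 \in K by exact: idealM.
have -> : h0 (v - r * s0) = h0 v - h0 (r * s0) := lin_onB hK vK rs0K.
by have -> : h0 (r * s0) = r *: s by rewrite -s0E; exact: lin_onZ hK r _ s0K.
Qed.

(** Duality is applied to the submodule mC. By faithfulness y mC lies in xC exactly when y m lies in
    xR, so its annihilator is xR : m, which computes Ext^1(R/m, R). *)
Lemma canonical_type (K : ideal R) (C : lmodType R) (h : R^o -> C) mu :
  canonical_module m C -> iso_on K h -> haslen (ideal_mul m K : ideal R) K mu ->
  length_Ext 1 (quotmod m) R^o = mu%:R%:E.
Proof.
move=> canC iso hmu; have nx := iso_on_nonzerodivisor iso.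
case: (iso) => hK inj surj.
set mK : ideal R := ideal_mul m K in hmu.
have mKK : {subset mK <= K} by exact: haslen_sub hmu.
have ImP : submodule_prop (fun c => exists2 a : R^o, a \in mK & h a = c).
  split; first by exists 0; [exact: sub0|exact: lin_on0 hK].
  move=> r _ _ [u um <-] [v vm <-]; exists (r *: u + v).
    by apply: subD => //; exact: subZ.
  by rewrite hK //; exact: mKK.
pose M := mksub ImP.
have hM : haslen M (full_sub C) mu.
  have H : hommod K M h by move=> r u v uK vK; rewrite hK // subrr sub0.
  apply/(haslen_iso H (A := mK)); last exact: hmu.
  split=> //.
  - by move=> c _; exact: full_subP.
  - by move=> c _; exact: full_subP.
  - move=> v vK; apply/idP/idP => [/mksubP[a am E]|vm]; last by apply/mksubP; exists v.
    by rewrite -(iso_on_inj iso (mKK _ am) vK E).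
  - by move=> c _; have [a aK <-] := surj c; exists a; rewrite ?subrr ?sub0.
have xM : {subset scale_image x C <= M}.
  move=> _ /scale_imageP[c ->]; have [a aK <-] := surj c.
  apply/mksubP; exists (x *: (a : R^o)); first exact: in_ideal_mul.
  by rewrite (lin_onZ hK).
have canE : canonical_module m C by [].
case: canE => _ _ E1 _; rewrite (dimn1 dimR) in E1.
have rxo : nonzerodivisor R^o x := rx.
apply: (length_Ext1_residue xm E1 rxo).
have := haslen_ann noethR locR xm px nx (canonical_liftable canC nx)
  (canonical_socle canC nx) xM hM.
have xRP (y : R) : y \in scale_image x R^o <-> y \in (line_sub (x : R^o) : ideal R).
  split=> [/asboolP[u ->]|/ideal_lineP[u ->]].
    by apply/ideal_lineP; exists u; exact: mulrC.
  by apply/asboolP; exists u; exact: mulrC.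
apply: haslen_eq => y; first by apply/idP/idP => /xRP.
apply/idP/idP => [/ann_subP yM|/colon_subP ym].
  apply/colon_subP => a am; apply/xRP.
  apply: (faithful_mod noethR locR xm px nx (canonical_liftable canC nx)
    (canonical_socle canC nx)) => c.
  rewrite [_ *: y]mulrC -scalerA; apply: yM.
  have [k kK <-] := surj c; apply/mksubP; exists (a *: (k : R^o)).
    exact: in_ideal_mul.
  by rewrite (lin_onZ hK).
apply/ann_subP => _ /mksubP[a am <-]; rewrite -(lin_onZ hK); last exact: mKK.
suff H : {subset mK <= (colon_sub (line_sub (y : R^o)) (scale_sub x K) : ideal R)}.
  have /H/colon_subP/(_ y (line_sub_id _))/scale_idealP[u uK ->] := am.
  by apply/scale_imageP; exists (h u); rewrite -(lin_onZ hK).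
apply: ideal_mul_min => b k bm kK; apply/colon_subP => _ /ideal_lineP[r ->].
have /asboolP[z zE] := ym b bm.
apply/scale_idealP; exists (r * (z * k)); first by apply: idealM; exact: idealM.
have {}zE : b * y = x * z := zE.
have -> : x * (r * (z * k)) = r * (x * z) * k by rewrite mulrCA !mulrA.
by rewrite -zE [LHS]mulrACA !mulrA.
Qed.

End CanonicalModule.

Section Multiplicity.
Variables (R : comNzRingType) (m : ideal R).
Hypotheses (noethR : noetherian R) (locR : local_ring m).
Hypothesis dimR : krull_dim R = 1%:E.

Lemma scale_line_mul (w : R) (M : ideal R) :
  ideal_mul (line_sub (w : R^o) : ideal R) M =i (scale_sub w M : ideal R).
Proof.
move=> y; apply/idP/idP => [|/scale_idealP[u uM ->]]; last first.
  by apply: in_ideal_mul => //; exact: line_sub_id.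
move: y; apply: ideal_mul_min => _ b /ideal_lineP[r ->] bM.
apply/scale_idealP; exists (r * b); first exact: idealM.
by rewrite [r * w]mulrC mulrA.
Qed.

(** As m^(n+1) = w m^n, w divides the regular element x^(n+1). *)
Lemma principal_reduction_regular (w x : R) : regular x -> x \in m ->
  reduction (line_sub (w : R^o)) m -> regular w.
Proof.
move=> rx xm [_ [n Hn]] r wr.
have : x ^+ n.+1 \in ideal_exp m n.+1 by exact: expr_ideal_exp.
rewrite Hn scale_line_mul => /scale_idealP[u _ E].
by apply: (regularX (n := n.+1) rx); rewrite E mulrAC wr mul0r.
Qed.

Lemma multiplicity_principal (w : R) e : regular w ->
  reduction (line_sub (w : R^o)) m -> haslen (line_sub (w : R^o)) (full_sub _) e ->
  multiplicity m = e%:R.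
Proof.
move=> rw redw he; have [n0 Hn0] := reductionS_ge redw.
have [l0 hl0] := haslen_quotient noethR locR (fun v (H : v \in ideal_exp m n0) => H).
have len k : haslen (ideal_exp m (n0 + k)) (full_sub R^o) (l0 + k * e).
  elim: k => [|k IH]; first by rewrite addn0 mul0n addn0.
  have := haslen_cat (haslen_scale_ideal rw IH he) IH.
  rewrite addnS mulSn addnCA; apply: haslen_eq => // y.
  by rewrite Hn0 ?leq_addr // scale_line_mul.
have lenq k : length (quotmod (ideal_exp m (n0 + k))) = (l0 + k * e)%:R%:E.
  exact: length_quotmod.
(* The colength of m^(n+1), not m^n, is l0 + (n + 1 - n0) e, whence the constant term. Agreement at
   all large n makes Q the only candidate for [xget]. *)
pose Q : {poly rat} := e%:R *: 'X + (l0%:R + e%:R - n0%:R * e%:R)%:P.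
have Q1 : 1`!%:R * Q`_1 = e%:R.
  by rewrite coefD coefZ coefX coefC mulr1 addr0 mul1r.
have QE n : (n0 <= n)%N ->
    length (quotmod (ideal_exp m n.+1)) = (Q.[n%:R])%:E.
  move=> n0n; have {1}-> : n.+1 = (n0 + (n.+1 - n0))%N by rewrite subnKC // leqW.
  rewrite lenq hornerD hornerZ hornerX hornerC; congr (_%:E).
  rewrite natrD natrM natrB; last exact: leqW.
  by rewrite -[n.+1]addn1 natrD mulrBl mulrDl mul1r !addrA [l0%:R + _]addrC mulrC.
rewrite /multiplicity (dimn1 dimR); apply: xget_unique.
  by exists Q => //; exists n0.
move=> _ [P [n1 HP] ->]; rewrite -Q1; suff -> : P = Q by [].
have PQ n : (n0 + n1 <= n)%N -> P.[n%:R] = Q.[n%:R].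
  move=> le; have := HP n (leq_trans (leq_addl _ _) le).
  by rewrite QE => [[]|]; last exact: leq_trans (leq_addr _ _) le.
apply/eqP; rewrite -subr_eq0; apply/negPn/negP => nz.
pose s := [seq n%:R : rat | n <- iota (n0 + n1) (size (P - Q))].
have : (size s < size (P - Q)%R)%N.
  apply: max_poly_roots nz _ _.
    apply/allP => _ /mapP[n + ->]; rewrite mem_iota => /andP[le _].
    by rewrite rootE hornerD hornerN PQ // subrr.
  by rewrite map_inj_uniq ?iota_uniq // => a b /eqP; rewrite eqr_nat => /eqP.
by rewrite size_map size_iota ltnn.
Qed.

End Multiplicity.

(** * Comparison of colengths and the almost Gorenstein condition *)

Section Comparison.
Variables (R : comNzRingType) (m : ideal R).
Hypotheses (noethR : noetherian R) (locR : local_ring m).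
Hypothesis dimR : krull_dim R = 1%:E.

Lemma scale_full (a : R) : scale_sub a (full_sub R^o) =i line_sub (a : R^o).
Proof.
move=> v; apply/idP/idP => [/scale_idealP[u _ ->]|/ideal_lineP[r ->]].
  by apply/ideal_lineP; exists u; exact: mulrC.
by apply/scale_idealP; exists r; [exact: full_subP|exact: mulrC].
Qed.

Lemma scale_mul (a : R) (I J : ideal R) :
  ideal_mul (scale_sub a I : ideal R) J =i (scale_sub a (ideal_mul I J) : ideal R).
Proof.
move=> y; apply/idP/idP; first (move: y; apply: ideal_mul_min).
  move=> _ j /scale_idealP[i iI ->] jJ; apply/scale_idealP; exists (i * j).
    exact: in_ideal_mul.
  by rewrite mulrA.
move=> /scale_idealP[u + ->]; move: u.
suff H : {subset ideal_mul I J <=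
    (colon_sub (line_sub (a : R^o)) (ideal_mul (scale_sub a I : ideal R) J) : ideal R)}.
  by move=> u /H/colon_subP/(_ a (line_sub_id _)).
apply: ideal_mul_min => i j iI jJ; apply/colon_subP => _ /ideal_lineP[r ->].
rewrite [_ *: _](_ : _ = a * i * (r * j)); last by rewrite [r * a]mulrC [LHS]mulrACA.
apply: in_ideal_mul; last exact: idealM.
by apply/scale_idealP; exists i.
Qed.

Lemma haslen_scale_full (a : R) (I : ideal R) n e : regular a ->
  haslen I (full_sub _) n -> haslen (line_sub (a : R^o)) (full_sub _) e ->
  haslen (scale_sub a I) (full_sub _) (n + e).
Proof.
move=> ra hI ha; have nra : nonzerodivisor R^o a := ra.
apply: haslen_cat ha.
have IF : {subset I <= full_sub R^o} by move=> v _; exact: full_subP.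
exact: haslen_eq (fun=> erefl) (scale_full a) ((haslen_scale _ nra IF).1 hI).
Qed.

Lemma iso_on_regular (K J : ideal R) (h : R^o -> submod J) (b : R) :
  iso_on K h -> regular b -> b \in K -> regular (val (h b) : R).
Proof.
move=> [hK inj surj] rb bK r ar; apply: rb; rewrite mulrC.
apply: inj; first exact: idealM.
have -> : h (r * b) = r *: h b := lin_onZ hK r bK.
by apply: val_inj; rewrite /= [LHS]mulrC.
Qed.

(* An isomorphism K -> J is multiplication by a fraction a/b; comparing the
   colengths of bJ = aK and of bJm^n = am^(n+1) gives the difference. *)
Lemma colength_difference (K J : ideal R) (h : R^o -> submod J) (b : R) n kK kJ :
  iso_on K h -> regular b -> b \in K -> {subset K <= m} -> {subset J <= m} ->
  primary m K ->
  haslen K (full_sub _) kK -> haslen J (full_sub _) kJ ->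
  ideal_exp m n.+1 =i ideal_mul K (ideal_exp m n) ->
  exists d, kJ = (kK + d)%N /\
    haslen (ideal_mul J (ideal_exp m n) : ideal R) (ideal_exp m n.+1) d.
Proof.
move=> iso rb bK Km Jm pK hk hj redK.
case: (iso) => hK inj surj; pose a : R := val (h b).
have aJ : a \in J by exact: (valP (h b)).
(* Compute h(b k) in two ways. *)
have hE k : k \in K -> b * val (h k) = a * k.
  move=> kK'; rewrite -[b * _]/(val (b *: h k)) -(lin_onZ hK) //.
  have -> : b *: (k : R^o) = k *: (b : R^o) by exact: mulrC.
  by rewrite (lin_onZ hK) // [LHS]mulrC.
have ra : regular a := iso_on_regular iso rb bK.
have bJaK : scale_sub b J =i scale_sub a K.
  move=> y; apply/idP/idP => /scale_idealP[u uI ->]; apply/scale_idealP.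
    have [k kK' kE] := surj (Sub u uI); exists k => //.
    by rewrite -hE // kE.
  by exists (val (h u)); [exact: (valP (h u))|rewrite hE].
have [na Ha] := regular_primary noethR locR dimR ra (Jm a aJ).
have [nb Hb] := regular_primary noethR locR dimR rb (Km b bK).
have [ea ha] := haslen_quotient noethR locR Ha.
have [eb hb] := haslen_quotient noethR locR Hb.
have e1 := haslen_uniq (haslen_eq bJaK (fun=> erefl) (haslen_scale_full rb hj hb))
  (haslen_scale_full ra hk ha).
have [l hl] := haslen_quotient noethR locR (fun v (H : v \in ideal_exp m n.+1) => H).
have JM : {subset ideal_mul J (ideal_exp m n) <= ideal_exp m n.+1} by exact: ideal_mulS.
have [l' hl'] : exists l', haslen (ideal_mul J (ideal_exp m n) : ideal R) (full_sub _) l'.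
  apply: (haslen_quotient noethR locR (n := na + n)) => y /ideal_expD.
  by apply: ideal_mulS => // z /Ha; exact: line_sub_min.
have [d [q [hd hq e2]]] := haslen_split JM (fun v _ => full_subP v) hl'.
have ql := haslen_uniq hq hl.
have E : scale_sub b (ideal_mul J (ideal_exp m n) : ideal R) =i
    scale_sub a (ideal_exp m n.+1).
  move=> y; rewrite -scale_mul.
  transitivity (y \in (scale_sub a (ideal_mul K (ideal_exp m n) : ideal R))).
    by rewrite -scale_mul; apply/idP/idP; apply: ideal_mulS => // z; rewrite bJaK.
  by apply/idP/idP => /scale_idealP[u um ->]; apply/scale_idealP; exists u => //;
    move: um; rewrite redK.
have e3 := haslen_uniq (haslen_eq E (fun=> erefl) (haslen_scale_full rb hl' hb))
  (haslen_scale_full ra hl ha).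
exists d; split=> //; clear -e1 e2 e3 ql; lia.
Qed.

(* Since w is part of a minimal generating set of K, the length of K/wR is
   (mu(K) - 1) + l((mK + wR)/wR). *)
Lemma principal_colength (K : ideal R) (w : R) e kK mu :
  w \in K -> w \notin ideal_mul m K ->
  haslen (line_sub (w : R^o)) (full_sub _) e -> haslen K (full_sub _) kK ->
  haslen (ideal_mul m K : ideal R) K mu ->
  exists d, e.+1 = (d + mu + kK)%N /\
    (d = 0%N <-> {subset ideal_mul m K <= (line_sub (w : R^o) : ideal R)}).
Proof.
move=> wK wmK he hk hmu; set mK : ideal R := ideal_mul m K in wmK hmu *.
have h1 := @haslen_step R m noethR locR R^o mK w wmK
  (fun a am => in_ideal_mul am wK).
set L := add_sub mK (line_sub (w : R^o)) in h1.
have LK : {subset L <= K}.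
  by apply: add_sub_min; [exact: haslen_sub hmu|exact: line_sub_min].
have [p [q [hp hq e1]]] := haslen_split (haslen_sub h1) LK hmu.
have p1 := haslen_uniq hp h1.
have wL : {subset line_sub (w : R^o) <= L} by exact: add_subr.
have KF : {subset K <= full_sub R^o} by move=> v _; exact: full_subP.
have wK' : {subset line_sub (w : R^o) <= K} by exact: line_sub_min.
have [s [t [hs ht e2]]] := haslen_split wK' KF he.
have tk := haslen_uniq ht hk.
have [d [q' [hd hq' e3]]] := haslen_split wL LK hs.
have qq := haslen_uniq hq' hq.
exists d; split; first by clear -p1 e1 e2 tk e3 qq; lia.
split=> [d0|sub].
  rewrite d0 in hd => y ym; apply: (haslen0_sub hd); exact: add_subl.
apply: (haslen_uniq hd); apply: haslen0 => //.
by apply: add_sub_min.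
Qed.

(** If w were in mK, then m^(n+1) = w m^n would lie in m m^(n+1) and vanish by Nakayama, while
    x^(n+1) is nonzero. *)
Lemma reduction_notin (K : ideal R) (w x : R) : regular x -> x \in m ->
  reduction (line_sub (w : R^o)) m -> {subset K <= m} -> w \notin ideal_mul m K.
Proof.
move=> rx xm [_ [n Hn]] Km; apply/negP => wmK.
have : {subset ideal_exp m n.+1 <= zero_sub R^o}.
  apply: (nakayama_ideal noethR locR) => y; rewrite Hn => yw.
  apply: add_subr; have : y \in ideal_mul (ideal_mul m K : ideal R) (ideal_exp m n).
    by apply: ideal_mulS yw => //; exact: line_sub_min.
  by move=> /ideal_mulAl; apply: ideal_mulS => // z; exact: ideal_mulS.
move=> /(_ _ (expr_ideal_exp n.+1 xm))/zero_subP x0.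
by have /eqP := regular_neq0 (regularX (n := n.+1) rx).
Qed.

(** An element r w of mK has r in m, as w is not in mK; so Km lies in wm. Then m^(n0+2) = K m m^n0
    lies in w m^(n0+1). *)
Lemma reduction_of_sub (K : ideal R) (w : R) : reduction K m -> w \in K ->
  w \notin ideal_mul m K ->
  {subset ideal_mul m K <= (line_sub (w : R^o) : ideal R)} ->
  reduction (line_sub (w : R^o)) m.
Proof.
move=> redK wK wmK sub; have [n0 Hn0] := reductionS_ge redK.
have Km := redK.1; have wm := Km w wK.
split; first exact: line_sub_min.
exists n0.+1 => y; apply/idP/idP; last by apply: ideal_mulS => //; exact: line_sub_min.
rewrite Hn0 // => H.
have {H} : y \in ideal_mul K (ideal_mul m (ideal_exp m n0) : ideal R) by exact: H.
move=> /ideal_mulAr.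
have sub' : {subset ideal_mul K m <= ideal_mul (line_sub (w : R^o) : ideal R) m}.
  move=> z /ideal_mulC zmK; have /ideal_lineP[r rE] := sub z zmK.
  rewrite rE mulrC; apply: in_ideal_mul; first exact: line_sub_id.
  apply: contrapT => /negP rm; case/negP: wmK.
  apply: (sub_unitZ noethR locR (V := R^o) rm).
  by move: zmK; rewrite rE.
move=> /(ideal_mulS sub' (fun _ => id)) /ideal_mulAl.
exact: ideal_mulS.
Qed.

(* If w itself lies in mK then mK = wR is invertible, so m and K are principal. *)
Lemma minimal_generator (K : ideal R) (w : R) : regular w -> w \in K ->
  {subset ideal_mul m K <= (line_sub (w : R^o) : ideal R)} ->
  exists w' : R, [/\ w' \in K, w' \notin ideal_mul m K &
    {subset ideal_mul m K <= (line_sub (w' : R^o) : ideal R)}].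
Proof.
move=> rw wK sub; case: (boolP (w \in ideal_mul m K)) => wmK; last by exists w.
(* If all these coefficients u were in m, then mK, and with it w, would lie in mw, forcing w = 0. *)
have [t [k [u [tm kK um E]]]] : exists t k u : R, [/\ t \in m, k \in K, u \notin m &
    t * k = u * w].
  apply: contrapT => nex.
  have H : {subset ideal_mul m K <= ideal_mul m (line_sub (w : R^o) : ideal R)}.
    apply: ideal_mul_min => t k tm kK.
    have /ideal_lineP[u uE] := sub _ (in_ideal_mul tm kK).
    rewrite uE; apply: in_ideal_mul; last exact: line_sub_id.
    by apply: contrapT => /negP um; apply: nex; exists t, k, u.
  have /zero_subP w0 : w \in (zero_sub R^o : ideal R).
    apply: (nakayama_ideal noethR locR (I := line_sub (w : R^o))); last exact: line_sub_id.
    move=> y /ideal_lineP[r ->]; apply: add_subr; apply: idealM; exact: H.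
  by have /eqP := regular_neq0 rw.
have [v vu] := unit_of_notin noethR locR um.
have wE : w = v * (t * k) by rewrite E mulrA vu mul1r.
have rt : regular t.
  move=> r tr; apply: rw; rewrite wE.
  by have -> : v * (t * k) * r = v * k * (t * r) by [rewrite [t * k]mulrC -!mulrA]; rewrite tr mulr0.
have Kk : {subset K <= (line_sub (k : R^o) : ideal R)}.
  move=> k' kK'; have /ideal_lineP[r rE] := sub _ (in_ideal_mul tm kK').
  apply/ideal_lineP; exists (r * v); apply: (regular_inj rt).
  by rewrite rE wE [v * _]mulrCA [r * _]mulrCA !mulrA.
exists k; split=> //; last by move=> y /ideal_mul_subr/Kk.
apply/negP => kmK; have /zero_subP k0 : k \in (zero_sub R^o : ideal R).
  apply: (nakayama_ideal noethR locR (I := K)) => // y /Kk/ideal_lineP[r ->].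
  by apply: add_subr; exact: idealM.
have /eqP := regular_neq0 rw; apply.
by rewrite wE [k]k0 !mulr0.
Qed.

End Comparison.

Lemma canonical_ideal_iso_ideal (R : comNzRingType) (m K J : ideal R) (x : R) :
  noetherian R -> local_ring m -> krull_dim R = 1%:E -> x \in m -> regular x ->
  primary m K -> canonical_ideal m K -> canonical_ideal m J ->
  exists h : R^o -> submod J, iso_on K h.
Proof.
move=> noethR locR dimR xm rx pK [_ [C0 can0 /lmod_iso_on[h0 iso0]]].
move=> [_ [C1 can1 isoJ]]; have [h1 iso1] := lmod_iso_on isoJ.
have nx1 := iso_on_nonzerodivisor rx iso1.
have [h [hK inj surj]] :=
  canonical_ideal_iso noethR locR dimR xm rx pK can0 iso0 can1 nx1.
have [f [g fK gK]] := isoJ; exists (fun a => g (h a)); split.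
- move=> r u v uK vK; apply: (can_inj fK).
  by rewrite gK linearP /= !gK hK.
- by move=> a aK ga; apply: inj => //; rewrite -[h a]gK ga linear0.
- by move=> c; have [a aK ha] := surj (f c); exists a; rewrite ?ha ?fK.
Qed.

(* If w in K is the image of 1 under R -> K_R = K, then mK is contained in wR. *)
Lemma almost_gorenstein_generator (R : comNzRingType) (m K : ideal R) :
  noetherian R -> local_ring m -> krull_dim R = 1%:E ->
  primary m K -> canonical_ideal m K -> almost_gorenstein m ->
  exists w : R, [/\ w \in K, w \notin ideal_mul m K &
    {subset ideal_mul m K <= (line_sub (w : R^o) : ideal R)}].
Proof.
move=> noethR locR dimR pK [_ [C0 can0 /lmod_iso_on[h0 iso0]]].
move=> [KR [C [f [g [canKR injf exfg _ mC]]]]].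
(* KR is not yet known to be isomorphic to K, so y is taken regular on KR; it is then regular on R,
   which embeds in KR. *)
have [y ym ny] : exists2 y : R, y \in m & nonzerodivisor KR y.
  by apply: depth1_regular; case: canKR => _ -> _ _.
have ry : regular y.
  move=> r yr; apply: injf; rewrite linear0; apply: ny; rewrite -linearZ.
  by rewrite [_ *: _]yr linear0.
have [h iso] := canonical_ideal_iso noethR locR dimR ym ry pK can0 iso0 canKR ny.
case: (iso) => hK inj surj; have [w wK wE] := surj (f 1).
have fE (r : R) : f r = h (r * w).
  have -> : h (r * w) = r *: h w := lin_onZ hK r wK.
  by rewrite wE -linearZ; congr (f _); rewrite [RHS]mulr1.
apply: (minimal_generator noethR locR _ wK).
  move=> r wr; apply: injf; rewrite linear0 fE mulrC wr.
  exact: lin_on0 hK.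
apply: ideal_mul_min => a k am kK.
have [r rE] : exists r, f r = a *: h k.
  by apply: exact_at_kernel exfg _; rewrite linearZ; exact: mC.
apply/ideal_lineP; exists r; apply: (iso_on_inj iso); try exact: idealM.
by rewrite -fE rE; have -> : h (a * k) = a *: h k := lin_onZ hK a kK.
Qed.

(** Send 1 to h(w); the cokernel is a copy of K/wR, which m kills. *)
Lemma almost_gorenstein_of_generator (R : comNzRingType) (m K : ideal R) (w : R) :
  canonical_ideal m K -> regular w -> w \in K ->
  {subset ideal_mul m K <= (line_sub (w : R^o) : ideal R)} ->
  almost_gorenstein m.
Proof.
move=> [_ [C can /lmod_iso_on[h iso]]] rw wK sub; case: (iso) => hK inj surj.
have fl : linear (fun r : R^o => (r : R) *: h w).
  by move=> r u v; rewrite scalerDl -scalerA.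
have [f fE] := linear_function fl.
have [g gE] := linear_function (quotmod_pi_linear (line_sub (h w))).
exists C, (quotmod (line_sub (h w))), f, g; split=> //.
- move=> r s; rewrite !fE -!(lin_onZ hK) // => e; apply: (regular_inj rw).
  rewrite mulrC [RHS]mulrC; apply: iso_on_inj iso _ _ e; exact: idealM.
- apply/seteqP; split=> c.
    move=> [r _ <-] /=; rewrite gE fE; apply/quotmod_pi0P/line_subP.
    by exists r.
  by rewrite /= gE => /quotmod_pi0P/line_subP[r ->]; exists r.
- apply/seteqP; split=> // c _; exists (repr c : C) => //.
  by rewrite gE quotmod_piK.
move=> a c am; rewrite -[c]quotmod_piK [_ *: _]quotmod_scale_pi.
apply/quotmod_pi0P; have [k kK <-] := surj (repr c).
have /ideal_lineP[r rE] := sub _ (in_ideal_mul am kK).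
apply/line_subP; exists r; rewrite -!(lin_onZ hK) //; congr h; exact: rE.
Qed.

Local Open Scope ereal_scope.

Theorem proposition3p3 (R : comNzRingType) (m K : ideal R)
  (cmR : cohen_macaulay_local m)
  (dimR : krull_dim R = 1)
  (infinite_residue_field : infinite_set [set: quotmod m])
  (canK : canonical_reduction m K) :
  let S := [set length (quotmod J) | J in [set J : ideal R | canonical_ideal m J]] in
  let e := (multiplicity m)%:E in
  let r := length_Ext 1 (quotmod m) R^o in
  [/\ forall J : ideal R, canonical_ideal m J ->
        length (quotmod K) <= length (quotmod J) /\
        (length (quotmod J) = length (quotmod K) <-> reduction J m),
      S (length (quotmod K)) /\ lbound S (length (quotmod K)),
      length (quotmod K) <= e - r + 1 &
      length (quotmod K) = e - r + 1 <-> almost_gorenstein m].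
Proof.
move=> S e r; have [noethR locR depR] := cmR; have [cK redK] := canK.
have [x xm rx] : exists2 x : R, x \in m & regular x.
  by have [|x xm rx] := @depth1_regular R m R^o; [rewrite depR|exists x].
have px := regular_primary noethR locR dimR rx xm.
have Km := redK.1; have [n0 Hn0] := reductionS_ge redK.
have expK : {subset ideal_exp m n0.+1 <= K}.
  by move=> y; rewrite Hn0 // => /ideal_mulC/ideal_mul_subr.
have pK : primary m K by exists n0.+1.
have [w wK redw] := principal_reduction noethR locR xm rx px infinite_residue_field redK.
have rw := principal_reduction_regular rx xm redw.
have [kK hK] := haslen_quotient noethR locR expK.
have [n Hn] := regular_primary noethR locR dimR rw (Km w wK).
have [e0 he] := haslen_quotient noethR locR Hn.
have [mu hmu] : exists mu, haslen (ideal_mul m K : ideal R) K mu.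
  have [|l hl] := @haslen_quotient R m noethR locR (ideal_mul m K) n0.+2.
    by move=> y; apply: ideal_mulS.
  have [||mu [q [hmu _ _]]] := haslen_split (B := K) _ _ hl; last by exists mu.
    exact: ideal_mul_subr.
  by move=> v _; exact: full_subP.
have lenK := length_quotmod hK.
have eE : e = e0%:R%:E by rewrite /e (multiplicity_principal noethR locR dimR rw redw he).
have rE : r = mu%:R%:E.
  have [_ [C0 can0 /lmod_iso_on[h0 iso0]]] := cK.
  exact: canonical_type noethR locR dimR xm rx _ _ _ _ can0 iso0 hmu.
have partA (J : ideal R) : canonical_ideal m J ->
    length (quotmod K) <= length (quotmod J) /\
    (length (quotmod J) = length (quotmod K) <-> reduction J m).
  move=> cJ; have [h iso] := canonical_ideal_iso_ideal noethR locR dimR xm rx pK cK cJ.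
  have Jm : {subset J <= m} by apply: (proper_sub_max noethR locR); case: cJ.
  have [kJ hJ] : exists kJ, haslen J (full_sub R^o) kJ.
    (* J has finite colength because it contains the regular element h(w). *)
    have ra := iso_on_regular iso rw wK; have aJ := valP (h w).
    have [na Ha] := regular_primary noethR locR dimR ra (Jm _ aJ).
    by apply: (haslen_quotient noethR locR (n := na)) => y /Ha; exact: line_sub_min.
  have diff n1 := colength_difference noethR locR dimR iso rw wK Km Jm pK hK hJ (n := n1).
  rewrite lenK (length_quotmod hJ); split.
    have [d [-> _]] := diff n0 (Hn0 n0 (leqnn _)).
    by rewrite lee_fin ler_nat leq_addr.
  split=> [[/eqP]|redJ].
    rewrite eqr_nat => /eqP E; have [d [dE hd]] := diff n0 (Hn0 n0 (leqnn _)).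
    have d0 : d = 0%N by lia.
    split=> //; exists n0 => y; rewrite d0 in hd.
    by apply/idP/idP; [exact: (haslen0_sub hd)|exact: (haslen_sub hd)].
  have [n1 Hn1] := reductionS_ge redJ.
  (* An exponent beyond both thresholds, where K m^n and J m^n both equal m^(n+1). *)
  have [d [dE hd]] := diff (maxn n0 n1) (Hn0 _ (leq_maxl _ _)).
  have d0 : d = 0%N.
    apply: (haslen_uniq hd); apply: haslen0 => y; rewrite Hn1 ?leq_maxr //.
  by rewrite dE d0 addn0.
have [d [dE dP]] := principal_colength noethR locR wK
  (reduction_notin noethR locR rx xm redw Km) he hK hmu.
have E : e - r + 1 = (kK + d)%:R%:E.
  rewrite eE rE -EFinB -EFinD; congr (_%:E).
  have : (e0.+1%:R = (d + mu + kK)%:R :> rat)%R by rewrite dE.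
  rewrite -natr1 !natrD => H.
  by rewrite addrAC H addrAC addrK addrC.
have eqE : length (quotmod K) = e - r + 1 <-> d = 0%N.
  rewrite lenK E; split=> [[/eqP]|->]; last by rewrite addn0.
  by rewrite eqr_nat -{1}[kK]addn0 eqn_add2l => /eqP.
split=> //.
- split; first by exists K.
  by move=> _ [J cJ <-]; exact: (partA J cJ).1.
- by rewrite lenK E lee_fin ler_nat leq_addr.
rewrite eqE; split=> [/dP sub|ag].
  exact: almost_gorenstein_of_generator cK rw wK sub.
(* w' need not be w, but it generates a reduction of m as well. Both colengths equal the
   multiplicity, so the defects d and d' coincide. *)
have [w' [wK' wmK' sub']] := almost_gorenstein_generator noethR locR dimR pK cK ag.
have redw' := reduction_of_sub noethR locR redK wK' wmK' sub'.
have rw' := principal_reduction_regular rx xm redw'.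
have [n' Hn'] := regular_primary noethR locR dimR rw' (Km w' wK').
have [e' he'] := haslen_quotient noethR locR Hn'.
have ee : e' = e0.
  apply/eqP; rewrite -(eqr_nat rat); apply/eqP.
  rewrite -(multiplicity_principal noethR locR dimR rw' redw' he').
  by rewrite -(multiplicity_principal noethR locR dimR rw redw he).
have [d' [dE' dP']] := principal_colength noethR locR wK' wmK' he' hK hmu.
have d0 : d' = 0%N by apply/dP'.
by rewrite ee in dE'; lia.
Qed.
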